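(* Let $1<p<\infty$, let $\Omega\subset\mathbb{R}^N$, $N\ge 2$, be a bounded domain with $\partial\Omega$ of class $\mathcal{C}^{0,1}$, let $c,h\in L^q(\Omega)$ for some $q>\max\{N/p,1\}$ with $c\gneqq 0$, let $\mu>0$ be a constant, and let $\lambda\le 0$. Then the problem $$-\Delta_p u=\lambda c(x)|u|^{p-2}u+\mu|\nabla u|^p+h(x),\qquad u\in W_0^{1,p}(\Omega)\cap L^\infty(\Omega),$$ has at most one solution.
   Context: $\Delta_p u=\operatorname{div}(|\nabla u|^{p-2}\nabla u)$. $c\gneqq 0$ means $c\ge 0$ a.e. in $\Omega$ and $c>0$ on a set of positive measure. A solution is a weak solution: $u\in W_0^{1,p}(\Omega)\cap L^\infty(\Omega)$ with $\int_\Omega|\nabla u|^{p-2}\nabla u\cdot\nabla\varphi\,dx=\int_\Omega\big(\lambda c|u|^{p-2}u+\mu|\nabla u|^p+h\big)\varphi\,dx$ for all $\varphi\in W_0^{1,p}(\Omega)\cap L^\infty(\Omega)$. *)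

(* Defs.v *)
From HB Require Import structures.
From mathcomp Require Import all_boot all_order all_algebra.
From mathcomp Require Import all_classical all_reals all_analysis.

Set Implicit Arguments.
Unset Strict Implicit.
Unset Printing Implicit Defensive.

Import Order.TTheory GRing.Theory Num.Theory.
Import numFieldNormedType.Exports.

Local Open Scope classical_set_scope.
Local Open Scope ring_scope.

(* The product sigma-algebra, generated by the coordinates: it is the Borel one,
   and makes 'rV[R]_n the counterpart of n.-tuple R with a topology on it. *)
Section measurable_rV.
Context (R : realType) (n : nat).

Definition rV_coord (i : 'I_n) (x : 'rV[R]_n) : R := x ord0 i.

Let rV_set0 : g_sigma_preimage rV_coord set0.
Proof. exact: sigma_algebra0. Qed.

Let rV_setC A : g_sigma_preimage rV_coord A -> g_sigma_preimage rV_coord (~` A).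
Proof. exact: sigma_algebraC. Qed.

Let rV_bigcup (F : (set 'rV[R]_n)^nat) :
  (forall i, g_sigma_preimage rV_coord (F i)) ->
  g_sigma_preimage rV_coord (\bigcup_i (F i)).
Proof. exact: sigma_algebra_bigcup. Qed.

HB.instance Definition _ := @isMeasurable.Build default_measure_display
  'rV[R]_n (g_sigma_preimage rV_coord) rV_set0 rV_setC rV_bigcup.

Lemma measurable_rV_coord (i : 'I_n) : measurable_fun setT (rV_coord i).
Proof.
move=> _ Y mY; rewrite setTI; apply: sub_sigma_algebra => /=.
rewrite -bigcup_seq/=; exists i => /=; first by rewrite mem_index_enum.
by exists Y => //; rewrite setTI.
Qed.

Lemma measurable_fun_rVP d (T : measurableType d) (f : T -> 'rV[R]_n) :
  (forall i, measurable_fun setT (rV_coord i \o f)) -> measurable_fun setT f.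
Proof.
move=> mf _ A mA; rewrite setTI.
have : g_sigma_preimage (fun i => rV_coord i \o f) `<=` measurable.
  apply: smallest_sub; first exact: sigma_algebra_measurable.
  move=> B; rewrite -bigcup_seq => -[i _ [C mC <-]].
  exact: mf.
apply; rewrite g_sigma_preimage_comp; exists A => //.
by rewrite setTI.
Qed.

End measurable_rV.

Section lebesgue_rV.
Context (R : realType).

Definition rV_cons n (z : measurableTypeR R * 'rV[R]_n) : 'rV[R]_n.+1 :=
  row_mx z.1%:M z.2.

Definition rV_uncons n (x : 'rV[R]_n.+1) : measurableTypeR R * 'rV[R]_n :=
  (x ord0 ord0, rsubmx (x : 'rV[R]_(1 + n))).

Lemma rV_consK n : cancel (@rV_cons n) (@rV_uncons n).
Proof.
move=> [a v]; rewrite /rV_uncons /rV_cons/=; congr pair; last exact: row_mxKr.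
have := row_mxEl (@scalar_mx R 1 a) v ord0 ord0.
rewrite [RHS]mxE eqxx mulr1n => aE; rewrite -[RHS]aE.
by congr (row_mx _ _ _ _); exact/val_inj.
Qed.

Lemma measurable_rV_cons n : measurable_fun setT (@rV_cons n).
Proof.
apply: measurable_fun_rVP => i.
have [j ->|j ->] := split_ordP (i : 'I_(1 + n)).
- rewrite (_ : _ \o _ = fst) //.
  apply/funext => z; apply: etrans (row_mxEl (@scalar_mx R 1 z.1) z.2 _ _) _.
  by rewrite !ord1 mxE eqxx mulr1n.
- rewrite (_ : _ \o _ = rV_coord j \o snd).
    by apply: measurableT_comp => //; exact: measurable_rV_coord.
  by apply/funext => z; exact: (row_mxEr (@scalar_mx R 1 z.1) z.2).
Qed.

HB.instance Definition _ n :=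
  isMeasurableFun.Build _ _ _ _ (@rV_cons n) (@measurable_rV_cons n).

Lemma measurable_rV_uncons n : measurable_fun setT (@rV_uncons n).
Proof.
apply: measurable_fun_pair; first exact: (measurable_rV_coord ord0).
apply: measurable_fun_rVP => i.
rewrite (_ : _ \o _ = rV_coord (rshift 1 i : 'I_n.+1)).
  exact: measurable_rV_coord.
by apply/funext => x; rewrite /rV_coord/= mxE.
Qed.


Section step.
Context (n : nat) (m : {sigma_finite_measure set 'rV[R]_n -> \bar R}).

Definition lebesgue_step : set 'rV[R]_n.+1 -> \bar R :=
  pushforward ((@lebesgue_measure R) \x m)%E (@rV_cons n).

Let step0 : lebesgue_step set0 = 0%E.
Proof. by rewrite /lebesgue_step /pushforward preimage_set0 measure0. Qed.

Let step_ge0 A : (0 <= lebesgue_step A)%E.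
Proof. by rewrite /lebesgue_step /pushforward; exact: measure_ge0. Qed.

Let step_additive : semi_sigma_additive lebesgue_step.
Proof. exact: measure_semi_sigma_additive. Qed.

HB.instance Definition _ :=
  isMeasure.Build _ _ _ lebesgue_step step0 step_ge0 step_additive.

Let step_sigma_finite : sigma_finite setT lebesgue_step.
Proof.
have /sigma_finiteP[F [TF ndF Foo]] := sigma_finiteT (@lebesgue_measure R).
have /sigma_finiteP[G [TG ndG Goo]] := sigma_finiteT m.
exists (fun k => @rV_uncons n @^-1` (F k `*` G k)).
  apply/seteqP; split => // x _.
  have [i _ Fi] : (\bigcup_i F i) (rV_uncons x).1 by rewrite -TF.
  have [j _ Gj] : (\bigcup_i G i) (rV_uncons x).2 by rewrite -TG.
  exists (maxn i j) => //; split.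
    by move: Fi; exact/subsetPset/ndF/leq_maxl.
  by move: Gj; exact/subsetPset/ndG/leq_maxr.
move=> k; have [mF Fk] := Foo k; have [mG Gk] := Goo k; split.
  rewrite -[X in measurable X]setTI; apply: measurable_rV_uncons => //.
  exact: measurableX.
rewrite /lebesgue_step /pushforward -comp_preimage.
rewrite (_ : _ \o _ = id); last by apply/funext => z /=; rewrite rV_consK.
by rewrite preimage_id product_measure1E// lte_mul_pinfty// ge0_fin_numE.
Qed.

HB.instance Definition _ :=
  Measure_isSigmaFinite.Build _ _ _ lebesgue_step step_sigma_finite.

End step.

Fixpoint lebesgue_rV (n : nat) : {sigma_finite_measure set 'rV[R]_n -> \bar R} :=
  match n with
  | 0%N => \d_(0 : 'rV[R]_0)
  | k.+1 => lebesgue_step (lebesgue_rV k)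
  end.

Lemma lebesgue_rV_box n (A : 'I_n -> set R) :
  (forall i, measurable (A i)) ->
  lebesgue_rV n [set x | forall i, A i (x ord0 i)] =
  (\prod_(i < n) (@lebesgue_measure R) (A i))%E.
Proof.
elim: n A => [|n IH] A mA.
  by rewrite big_ord0 /= diracE mem_set// => -[].
pose B := [set x : 'rV[R]_n | forall i, A (lift ord0 i) (x ord0 i)].
have mB : measurable B.
  have -> : B = \bigcap_(i in [set: 'I_n]) (rV_coord i @^-1` A (lift ord0 i)).
    by apply/seteqP; split => [x + i _|x + i]; [exact|move/(_ i I)].
  apply: fin_bigcap_measurable => [|i _]; first exact: finite_finset.
  by rewrite -[X in measurable X]setTI; exact: measurable_rV_coord.
have cons0 z : @rV_cons n z ord0 ord0 = z.1.
  exact: (congr1 fst (rV_consK z)).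
have consS z (i : 'I_n) : @rV_cons n z ord0 (lift ord0 i) = z.2 ord0 i.
  have <- : (rV_uncons (rV_cons z)).2 = z.2 by rewrite rV_consK.
  rewrite [RHS]mxE; congr (fun_of_matrix _ _ _).
  exact/val_inj.
rewrite big_ord_recl -IH; last by move=> i; exact: mA.
have mA0 : measurable (A ord0 : set (measurableTypeR R)) := mA ord0.
apply: etrans (product_measure1E (@lebesgue_measure R) (lebesgue_rV n) mA0 mB).
rewrite /= /lebesgue_step /pushforward; congr (product_measure1 _ _ _).
apply/seteqP; split => [z Az|z [Az0 AzS] i]/=.
  by split => [|i]; [rewrite -cons0; exact: Az|rewrite -consS; exact: Az].
by have [j ->|->] := unliftP ord0 i; [rewrite consS; exact: AzS|rewrite cons0].
Qed.

End lebesgue_rV.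

Section euclidean.
Context (R : realType) (N : nat).
Implicit Types x y : 'rV[R]_N.

Definition dotv x y : R := \sum_(i < N) x ord0 i * y ord0 i.

(* The norm `|x| of 'rV[R]_N is the sup norm; this is the Euclidean one. *)
Definition enorm x : R := Num.sqrt (dotv x x).

(* Boundary of class C^{0,1}: near each boundary point, in suitable orthonormal
   coordinates y = x Q, the set is the strict epigraph of a Lipschitz function
   of the coordinates other than y_i. *)
Definition lipschitz_boundary (Omega : set 'rV[R]_N) :=
  forall x0, (closure Omega `\` interior Omega) x0 ->
  exists (Q : 'M[R]_N) (i : 'I_N) (gamma : 'rV[R]_N.-1 -> R) (k : R),
    [/\ Q *m Q^T = 1%:M, k.-lipschitz gamma &
      \forall x \near x0,
        Omega x <-> gamma (col' i (x *m Q)) < (x *m Q) ord0 i].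

End euclidean.

Section sobolev.
Context (R : realType) (N : nat) (Omega : set 'rV[R]_N).
Implicit Types (u phi : 'rV[R]_N -> R) (g : 'rV[R]_N -> 'rV[R]_N).

Local Notation leb := (lebesgue_rV R N).

Definition pderiv (i : 'I_N) u : 'rV[R]_N -> R :=
  fun x => 'D_(delta_mx ord0 i) u x.

(* C^oo: all iterated partial derivatives are (Frechet) differentiable. *)
Definition smooth u :=
  forall (s : seq 'I_N) x, differentiable (foldr pderiv u s) x.

Definition test_function phi :=
  let supp := closure [set x | phi x != 0] in
  [/\ smooth phi, compact supp & supp `<=` Omega].

(* Functions are total on R^N; only their values on Omega matter. *)
Definition Lp (p : \bar R) u := u \_ Omega \in Lfun leb p.

Definition Lp_norm (p : \bar R) u : \bar R :=
  ('N[leb]_p [EFin \o (u \_ Omega)])%E.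

(* u is in W^{1,p}(Omega) and g is its weak gradient, which is determined by u
   up to equality almost everywhere in Omega. *)
Definition W1p_grad (p : \bar R) u g :=
  [/\ Lp p u, forall i, Lp p (fun x => g x ord0 i) &
    forall phi, test_function phi -> forall i,
      (\int[leb]_(x in Omega) (u x * pderiv i phi x) =
       - \int[leb]_(x in Omega) (g x ord0 i * phi x))%R].

(* The closure of the test functions in W^{1,p}(Omega). *)
Definition W01p (p : \bar R) u :=
  exists g (phi : nat -> 'rV[R]_N -> R),
    [/\ W1p_grad p u g, forall k, test_function (phi k),
      Lp_norm p (phi k \- u) @[k --> \oo] --> 0%E &
      forall i, Lp_norm p (fun x => pderiv i (phi k) x - g x ord0 i)
        @[k --> \oo] --> 0%E].

(* The nonlinear terms use 0 `^ a = 0 for a != 0, so that enorm v `^ (p - 2) *: v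
   vanishes at v = 0 for every p > 1, as |v|^{p-2} v is understood to do. *)
Definition weak_solution (p lambda mu : R) (c h : 'rV[R]_N -> R) u :=
  [/\ W01p p%:E u, Lp +oo%E u &
    forall gu, W1p_grad p%:E u gu ->
    forall phi gphi, W01p p%:E phi -> Lp +oo%E phi -> W1p_grad p%:E phi gphi ->
      (\int[leb]_(x in Omega)
         dotv (enorm (gu x) `^ (p - 2) *: gu x) (gphi x) =
       \int[leb]_(x in Omega)
         ((lambda * c x * `|u x| `^ (p - 2) * u x + mu * enorm (gu x) `^ p + h x)
           * phi x))%R].

End sobolev.

(* Main.v *)
Require Import Defs.
From mathcomp Require Import all_boot all_order all_algebra.
From mathcomp Require Import all_classical all_reals all_analysis.
From mathcomp Require Import measurable_realfun ess_sup_inf.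
From mathcomp Require Import ring lra.

(** Put beta = mu / (p - 1) and a = p beta. Both equations are tested with the
    same function phi = e^(a u) - e^(a v). Behind this choice is the change of
    unknown w = e^(beta u), which removes the gradient term from the equation:
    phi is w1^p - w2^p, the quantity of the Diaz-Saa and Picone inequalities.

    Subtract the two identities and write X, Y for the gradients of u, v and
    U = e^(a u), V = e^(a v). The source h cancels, and all terms that contain
    gradients combine (flux_identity) into

      beta (U gap(X, Y) + V gap(Y, X)),
      gap(X, Y) = |X|^p + (p - 1) |Y|^p - p |Y|^(p-2) Y.X,

    where gap(X, Y) is what is lost in the Young and Cauchy-Schwarz inequalities;
    it is nonnegative, and zero only for X = Y (young_gapP). What remains,
    - lambda c (|u|^(p-2) u - |v|^(p-2) v) (U - V), is nonnegative because
    lambda <= 0 and both factors are increasing in u. A nonnegative function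
    with integral zero vanishes, so u and v have the same gradient
    (weak_solution_grad_eq), and a function of W_0^{1,p} without gradient is zero
    (w01p_lim_grad0).

    Two points need care. The exponential is not globally Lipschitz, while the
    approximations of u by test functions are not uniformly bounded; so e^(a t) - 1
    is replaced by texp a K t = e^(a K sin (t / K)) - 1, which has bounded first and
    second derivatives and hence acts on W_0^{1,p} (w01p_lim_comp). For K tending to
    infinity it converges with its derivative, boundedly on bounded sets, and
    dominated convergence passes to the limit in the subtracted identity. The
    other point is integration by parts, for which everything is reduced to
    test functions, where it says that a partial derivative has integral zero
    (integral_pderiv0). *)

Set Implicit Arguments.
Unset Strict Implicit.
Unset Printing Implicit Defensive.

Import Order.TTheory GRing.Theory Num.Theory.
Import numFieldNormedType.Exports.

Local Open Scope classical_set_scope.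
Local Open Scope ring_scope.

(** * Borel sets of row vectors *)

Section borel_rV.
Context (R : realType) (n : nat).
Implicit Types (x y : 'rV[R]_n).

Lemma measurable_rV_ball x (e : R) : 0 < e -> measurable (ball x e).
Proof.
move=> e0.
have -> : ball x e =
    \bigcap_(i in [set: 'I_n]) (@rV_coord R n i @^-1` ball (x ord0 i) e).
  apply/seteqP; split => [y [_ h] i _|y h]; first exact: h.
  by split => // i j; rewrite (ord1 i); exact: h.
apply: fin_bigcap_measurable => [|i _]; first exact: finite_finset.
rewrite -[X in measurable X]setTI; apply: measurable_rV_coord => //.
rewrite ball_itv; exact: measurable_itv.
Qed.

(** An open set is the union of the balls with rational centre and radius
    1 / (k + 1) that it contains, and there are countably many of them. *)
Lemma open_measurable_rV (A : set 'rV[R]_n) : open A -> measurable A.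
Proof.
move=> oA.
pose c (s : 'rV[rat]_n * nat) : set 'rV[R]_n :=
  ball (map_mx ratr s.1 : 'rV[R]_n) (s.2.+1%:R^-1).
have -> : A = \bigcup_s (if `[< c s `<=` A >] then c s else set0).
  apply/seteqP; split => [x Ax|x [s _]]; last first.
    by case: asboolP => // h; exact: h.
  have /nbhs_ballP[e /= e0 eA] := open_nbhs_nbhs (conj oA Ax).
  have [k ke] : exists k : nat, k.+1%:R^-1 < e / 2 :> R.
    have e20 : 0 < e / 2 by rewrite divr_gt0.
    by have [k _ hk] := near_infty_natSinv_lt (PosNum e20); exists k; apply: hk => /=.
  have k0 : (0 : R) < k.+1%:R^-1 by rewrite invr_gt0.
  have /choice[q qP] : forall i : 'I_n, exists q : rat,
      ball (x ord0 i) (k.+1%:R^-1) (ratr q : R).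
    move=> i; have [y [xy [q _ qy]]] := @dense_rat R _
      (ex_intro _ (x ord0 i) (ballxx (x ord0 i) k0)) (ball_open _ _).
    by exists q; rewrite qy.
  have cx : c (\row_i q i, k) x.
    by split => // i j; rewrite (ord1 i) !mxE; exact/ball_sym/qP.
  exists (\row_i q i, k) => //; case: asboolP => // -[] y cy; apply: eA.
  rewrite (splitr e); apply: (@ball_triangle _ _ (map_mx ratr (\row_i q i) : 'rV[R]_n)).
    by apply: le_ball (ball_sym cx); exact: ltW.
  by apply: le_ball cy; exact: ltW.
apply: countable_bigcupT_measurable => [|s]; first exact: countableP.
by case: asboolP => // _; apply: measurable_rV_ball; rewrite invr_gt0.
Qed.

Lemma continuous_measurable_rV (f : 'rV[R]_n -> R) :
  continuous f -> measurable_fun setT f.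
Proof.
move=> cf; apply: (measurability _ (RGenOpens.measurableE R)) => _ [_ [a [b ->] <-]].
rewrite setTI; apply: open_measurable_rV.
by apply: open_comp => // x _; exact: cf.
Qed.

Lemma lebesgue_rV_bounded (A : set 'rV[R]_n) (r : R) : measurable A ->
  (forall x, A x -> `|x| <= r) -> (lebesgue_rV R n A < +oo)%E.
Proof.
move=> mA Ar.
pose B (i : 'I_n) : set R := `[- r, r]%classic.
have mB (i : 'I_n) : measurable (B i) by exact: measurable_itv.
have mBox : measurable [set x : 'rV[R]_n | forall i, B i (x ord0 i)].
  have -> : [set x : 'rV[R]_n | forall i, B i (x ord0 i)] =
      \bigcap_(i in [set: 'I_n]) (rV_coord i @^-1` B i).
    by apply/seteqP; split => [x + i _|x + i]; [exact|move/(_ i I)].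
  apply: fin_bigcap_measurable => [|i _]; first exact: finite_finset.
  by rewrite -[X in measurable X]setTI; exact: measurable_rV_coord.
apply: (@le_lt_trans _ _ (lebesgue_rV R n [set x | forall i, B i (x ord0 i)])).
  apply: le_measure; rewrite ?inE// => x Ax i.
  rewrite /B /= in_itv/= -ler_norml (le_trans _ (Ar _ Ax))//.
  rewrite [leRHS]mx_normrE; exact: (le_bigmax _ _ (ord0, i)).
rewrite lebesgue_rV_box// ltey_eq; apply/orP; left.
elim/big_ind : _ => [//|a b|i _]; first exact: fin_numM.
by rewrite lebesgue_measure_itv/=; case: ifP.
Qed.

End borel_rV.

(** * Partial derivatives of compactly supported functions have integral zero *)

Section integral_pderiv.
Context (R : realType).

Lemma rV_cons0 n (z : measurableTypeR R * 'rV[R]_n) : rV_cons z ord0 ord0 = z.1.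
Proof. exact: (congr1 fst (rV_consK z)). Qed.

Lemma rV_consS n (z : measurableTypeR R * 'rV[R]_n) (i : 'I_n) :
  rV_cons z ord0 (lift ord0 i) = z.2 ord0 i.
Proof.
have <- : (rV_uncons (rV_cons z)).2 = z.2 by rewrite rV_consK.
by rewrite [RHS]mxE; congr (fun_of_matrix _ _ _); exact/val_inj.
Qed.

(** Together with [rV_consDr], the reason why a partial derivative commutes with
    freezing other variables, as the induction on the dimension in
    [integral_pderiv0] requires. *)
Lemma rV_consDl n (t h : R) (y : 'rV[R]_n) :
  rV_cons (h + t, y) = h *: delta_mx ord0 ord0 + rV_cons (t, y).
Proof.
apply/rowP => i; have [j ->|->] := unliftP ord0 i.
  by rewrite [RHS]mxE !rV_consS/= !mxE mulr0 add0r.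
by rewrite [RHS]mxE !rV_cons0 !mxE !eqxx mulr1.
Qed.

Lemma rV_consDr n (t h : R) (j : 'I_n) (y : 'rV[R]_n) :
  rV_cons (t, h *: delta_mx ord0 j + y) =
  h *: delta_mx ord0 (lift ord0 j) + rV_cons (t, y).
Proof.
apply/rowP => i; have [k ->|->] := unliftP ord0 i.
  by rewrite [RHS]mxE !rV_consS/= !mxE (inj_eq lift_inj).
by rewrite [RHS]mxE !rV_cons0/= !mxE /= mulr0 add0r.
Qed.

Lemma le_normr_coord n (x : 'rV[R]_n) i : `|x ord0 i| <= `|x|.
Proof. by rewrite [leRHS]mx_normrE; exact: (le_bigmax _ _ (ord0, i)). Qed.

Lemma rV_cons_normr n (t : R) (y : 'rV[R]_n) : `|y| <= `|rV_cons (t, y)|.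
Proof.
rewrite [leLHS]mx_normrE; apply/bigmax_leP; split => // -[i j] _ /=.
by rewrite (ord1 i) -(rV_consS (t, y)) le_normr_coord.
Qed.

Lemma rV_cons_norml n (t : R) (y : 'rV[R]_n) : `|t| <= `|rV_cons (t, y)|.
Proof. by have := le_normr_coord (rV_cons (t, y)) ord0; rewrite rV_cons0. Qed.

Lemma continuous_rV (T : topologicalType) n (f : T -> 'rV[R]_n) :
  (forall i, continuous (fun x => f x ord0 i)) -> continuous f.
Proof.
move=> cf x A [B fB sBA].
have : \forall y \near x, forall i : 'I_n, B ord0 i (f y ord0 i).
  by apply: filter_forall => i; exact: cf (fB ord0 i).
by apply: filterS => y By; apply: sBA => i j; rewrite (ord1 i).
Qed.

Lemma continuous_rV_consl n (y : 'rV[R]_n) : continuous (fun t : R => rV_cons (t, y)).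
Proof.
apply: continuous_rV => i; have [j ->|->] := unliftP ord0 i.
  by under eq_fun do rewrite rV_consS; exact: cst_continuous.
by under eq_fun do rewrite rV_cons0.
Qed.

Lemma continuous_rV_consr n (t : R) : continuous (fun y : 'rV[R]_n => rV_cons (t, y)).
Proof.
apply: continuous_rV => i; have [j ->|->] := unliftP ord0 i.
  by under eq_fun do rewrite rV_consS; exact: coord_continuous.
by under eq_fun do rewrite rV_cons0; exact: cst_continuous.
Qed.

Lemma open_norm_gt (V : normedModType R) (r : R) : open [set x : V | r < `|x|].
Proof.
apply: (@open_comp _ _ (fun x : V => `|x|) [set y | r < y]).
  by move=> x _; exact: norm_continuous.
exact: open_gt.
Qed.

Lemma rV_ball_compact n (r : R) : compact [set x : 'rV[R]_n | `|x| <= r].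
Proof.
have [r0|r0] := ltP r 0.
  rewrite (_ : [set _ | _] = set0); first exact: compact0.
  by apply/seteqP; split => // x /= /(le_trans (normr_ge0 _)); rewrite leNgt r0.
have -> : [set x : 'rV[R]_n | `|x| <= r] =
    [set x : 'rV[R]_n | forall i, `[- r, r]%classic (x ord0 i)].
  apply/seteqP; split => x /= xr.
    by move=> i; rewrite in_itv/= -ler_norml (le_trans (le_normr_coord _ _)).
  rewrite [leLHS]mx_normrE; apply/bigmax_leP; split => // -[i j] _ /=.
  by rewrite (ord1 i) ler_norml; have := xr j; rewrite in_itv.
by apply: (@rV_compact R n (fun=> `[- r, r]%classic)) => i; exact: segment_compact.
Qed.

Lemma compact_support_bounded (T : topologicalType) (K : set T) (f : T -> R) :
  compact K -> continuous f -> (forall x, ~ K x -> f x = 0) ->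
  exists M, forall x, `|f x| <= M.
Proof.
move=> cK cf fK.
have /compact_bounded[M [_ MP]] : compact (f @` K).
  by apply: continuous_compact => //; exact: continuous_subspaceT.
exists (`|M| + 1) => x; have [Kx|nKx] := pselect (K x).
  apply: (MP (`|M| + 1)); last by exists x.
  by rewrite (le_lt_trans (ler_norm _))// ltrDl.
by rewrite fK// normr0 addr_ge0.
Qed.

Lemma compact_support_integrable n (f : 'rV[R]_n -> R) (r : R) :
  continuous f -> (forall x, r < `|x| -> f x = 0) ->
  (lebesgue_rV R n).-integrable setT (EFin \o f).
Proof.
move=> cf f0; pose B := [set x : 'rV[R]_n | `|x| <= r].
have mB : measurable B.
  rewrite -[B]setCK; apply: measurableC; apply: open_measurable_rV.
  rewrite (_ : ~` B = [set x | r < `|x|]); last first.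
    by apply/seteqP; split => x /=; rewrite ltNge => /negP.
  exact: open_norm_gt.
have [M fM] : exists M, forall x, `|f x| <= M.
  apply: (@compact_support_bounded _ B) => //; first exact: rV_ball_compact.
  by move=> x /negP; rewrite -ltNge; exact: f0.
rewrite (_ : EFin \o f = (EFin \o f) \_ B); last first.
  apply/funext => x; rewrite patchE; case: ifPn => // /negP xB /=.
  by rewrite f0// ltNge; apply/negP => xr; apply: xB; rewrite inE.
apply/(integrable_mkcond _ mB).1; apply: measurable_bounded_integrable => //.
- by apply: (@lebesgue_rV_bounded _ _ _ r).
- by apply: measurable_funTS; exact: continuous_measurable_rV.
- exists M; split; first exact: num_real.
  by move=> z Mz x _ /=; rewrite (le_trans (fM x))// ltW.
Qed.

(** The region where the norm exceeds r is open, so f is zero near each of its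
    points. *)
Lemma pderiv_out n (i : 'I_n) (f : 'rV[R]_n -> R) (r : R) :
  (forall x, r < `|x| -> f x = 0) -> forall x, r < `|x| -> pderiv i f x = 0.
Proof.
move=> f0 x xr; rewrite /pderiv (@near_eq_derive _ _ _ f (cst 0)).
  exact: derive_cst.
have : nbhs (x : 'rV[R]_n) [set y | r < `|y|].
  by apply: open_nbhs_nbhs; split => //; exact: open_norm_gt.
by apply: filterS => y; exact: f0.
Qed.

(** The one-dimensional case, by the fundamental theorem of calculus on an
    interval whose end points lie outside the support. *)
Lemma integral_line_derive0 (f : R -> R) (r : R) :
  (forall t, derivable f t 1) -> continuous (derive1 f) ->
  (forall t, r < `|t| -> f t = 0) ->
  (\int[lebesgue_measure]_t (derive1 f t)%:E = 0)%E.
Proof.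
move=> df cf f0; pose s : R := `|r| + 1.
have rs : r < s by rewrite (le_lt_trans (ler_norm _))// ltrDl.
have s0 : 0 < s by rewrite ltr_wpDl.
have cf0 : continuous f.
  by move=> t; apply: differentiable_continuous; exact/derivable1_diffP.
transitivity (\int[lebesgue_measure]_(t in `[(- s)%R, s]) (derive1 f t)%:E)%E.
  rewrite [RHS]integral_mkcond; apply: eq_integral => t _.
  rewrite patchE; case: ifPn => // /negP ts; congr EFin.
  have rt : r < `|t|.
    rewrite ltNge; apply/negP => tr; apply: ts; rewrite inE/= in_itv/= -ler_norml.
    by rewrite (le_trans tr)// ltW.
  rewrite derive1E (@near_eq_derive _ _ _ f (cst 0)); first exact: derive_cst.
  have : nbhs t [set y | r < `|y|].
    by apply: open_nbhs_nbhs; split => //; exact: open_norm_gt.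
  by apply: filterS => y; exact: f0.
have Ns : - s < s by rewrite gtrN.
have cfs : {within `[- s, s], continuous (derive1 f)} by exact: continuous_subspaceT.
have dfs : derivable_oo_LRcontinuous f (- s) s.
  by split; [move=> t _; exact: df|exact/cvg_at_right_filter/cf0|exact/cvg_at_left_filter/cf0].
rewrite (continuous_FTC2 Ns cfs dfs)//.
by rewrite !f0 ?subee// ?normrN gtr0_norm.
Qed.

(** The measure in dimension n + 1 is the image of a product measure, which makes
    Fubini's theorem available. *)
Lemma integral_rV_cons n (g : 'rV[R]_n.+1 -> \bar R) :
  let m := ((@lebesgue_measure R) \x lebesgue_rV R n)%E in
  (lebesgue_rV R n.+1).-integrable setT g ->
  m.-integrable setT (g \o @rV_cons R n) /\
  (\int[lebesgue_rV R n.+1]_x g x = \int[m]_z g (rV_cons z))%E.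
Proof.
move=> m ig; have mg := measurable_int _ ig.
have igc : m.-integrable setT (g \o @rV_cons R n).
  apply/integrableP; split.
    exact: (measurableT_comp mg (@measurable_rV_cons R n)).
  have /integrableP[_] := ig; apply: le_lt_trans.
  have mag : measurable_fun setT (fun x => `|g x|)%E by exact: measurableT_comp.
  by rewrite [leRHS](ge0_integral_pushforward (@measurable_rV_cons R n) m measurableT mag).
split => //.
exact: (integral_pushforward (@measurable_rV_cons R n) mg igc measurableT).
Qed.

(** Fubini's theorem separates the first variable. A derivative in that variable
    integrates to zero along each line; a derivative in another variable
    integrates to zero on each slice by the induction hypothesis. *)
Lemma integral_pderiv0 n (i : 'I_n) (f : 'rV[R]_n -> R) (r : R) :
  (forall x, derivable f x (delta_mx ord0 i)) -> continuous (pderiv i f) ->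
  (forall x, r < `|x| -> f x = 0) ->
  (\int[lebesgue_rV R n]_x (pderiv i f x)%:E = 0)%E.
Proof.
elim: n i f => [[]//|n IH] i f df cf f0.
have f'0 := pderiv_out i f0.
have [ifc ->] := integral_rV_cons (compact_support_integrable cf f'0).
have [j ij|i0] := unliftP ord0 i.
- have derE t (y : 'rV[R]_n) :
      (fun h => h^-1 *: ((fun y => f (rV_cons (t, y))) (h *: delta_mx ord0 j + y)
                 - f (rV_cons (t, y)))) =
      (fun h => h^-1 *: (f (h *: delta_mx ord0 i + rV_cons (t, y)) - f (rV_cons (t, y)))).
    by apply/funext => h; rewrite rV_consDr ij.
  rewrite -(integral12_prod_meas1 ifc) /fubini_F /=.
  rewrite -[RHS](@integral0 _ _ _ (@lebesgue_measure R) setT).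
  apply: eq_integral => t _.
  rewrite -(IH j (fun y => f (rV_cons (t, y)))).
  + apply: eq_integral => y _; congr EFin.
    by rewrite /pderiv /derive /= derE.
  + move=> y; rewrite /derivable /= derE; exact: df.
  + rewrite (_ : pderiv _ _ = pderiv i f \o (fun y => rV_cons (t, y))).
      by move=> y; apply: continuous_comp; [exact: continuous_rV_consr|exact: cf].
    by apply/funext => y; rewrite /pderiv /derive /= derE.
  + by move=> y ry; apply: f0; rewrite (lt_le_trans ry)// rV_cons_normr.
- have derE t (y : 'rV[R]_n) :
      (fun h => h^-1 *: (f (rV_cons (h + t, y)) - f (rV_cons (t, y)))) =
      (fun h => h^-1 *: (f (h *: delta_mx ord0 i + rV_cons (t, y)) - f (rV_cons (t, y)))).
    by apply/funext => h; rewrite rV_consDl i0.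
  have derE1 t (y : 'rV[R]_n) :
      derive1 (fun t => f (rV_cons (t, y))) t = pderiv i f (rV_cons (t, y)).
    by rewrite /derive1 /= derE.
  rewrite -(integral21_prod_meas1 ifc) /fubini_G /=.
  rewrite -[RHS](@integral0 _ _ _ (lebesgue_rV R n) setT).
  apply: eq_integral => y _.
  rewrite -(@integral_line_derive0 (fun t => f (rV_cons (t, y))) r).
  + by apply: eq_integral => t _; rewrite derE1.
  + move=> t; rewrite /derivable /=.
    under eq_fun do rewrite -[X in f (rV_cons (X + _, _))]/(_ * 1)  mulr1.
    rewrite derE; exact: df.
  + rewrite (_ : derive1 _ = pderiv i f \o (fun t => rV_cons (t, y))).
      by move=> t; apply: continuous_comp; [exact: continuous_rV_consl|exact: cf].
    by apply/funext => t; exact: derE1.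
  + by move=> t rt; apply: f0; rewrite (lt_le_trans rt)// rV_cons_norml.
Qed.

End integral_pderiv.

(** * Smooth functions *)

Section smooth_closure.
Context (R : realType) (N : nat).
Implicit Types (f g : 'rV[R]_N -> R) (G : nat -> R -> R).

Lemma pderivM f g i x : differentiable f x -> differentiable g x ->
  pderiv i (fun y => f y * g y) x = f x * pderiv i g x + g x * pderiv i f x.
Proof. by move=> df dg; rewrite /pderiv deriveM//; exact: diff_derivable. Qed.

Lemma pderivD f g i x : differentiable f x -> differentiable g x ->
  pderiv i (fun y => f y + g y) x = pderiv i f x + pderiv i g x.
Proof. by move=> df dg; rewrite /pderiv deriveD//; exact: diff_derivable. Qed.

Lemma pderiv_cst (a : R) (i : 'I_N) : pderiv i (fun=> a) = fun=> 0.
Proof. by apply/funext => x; rewrite /pderiv derive_cst. Qed.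

Lemma pderiv_coord (i j : 'I_N) :
  pderiv i (fun x : 'rV[R]_N => x ord0 j) = fun=> (i == j)%:R.
Proof.
apply/funext => x; apply: lim_near_cst => //; near=> h.
rewrite /= !mxE eqxx/= addrK eq_sym.
by rewrite scalerA mulVf ?scale1r//; near: h; exact: nbhs_dnbhs_neq.
Unshelve. all: by end_near. Qed.

Lemma differentiable_comp1 (F F' : R -> R) f x :
  is_derive (f x) 1 F (F' (f x)) -> differentiable f x ->
  differentiable (fun y => F (f y)) x.
Proof.
move=> dF df; apply: (@differentiable_comp _ _ _ _ f F) => //.
exact/derivable1_diffP.
Qed.

Lemma pderiv_comp1 (F F' : R -> R) f i x :
  is_derive (f x) 1 F (F' (f x)) -> differentiable f x ->
  pderiv i (fun y => F (f y)) x = F' (f x) * pderiv i f x.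
Proof.
move=> dF df; rewrite /pderiv.
have dF' : differentiable F (f x) by exact/derivable1_diffP.
rewrite deriveE; last exact: (@differentiable_comp1 F F').
rewrite (@diff_comp _ _ _ _ f F)//= -(deriveE _ df).
rewrite -[X in 'd F _ X]mulr1 -[X in 'd F _ X]/(_ *: (1 : R)) linearZ/=.
by rewrite -deriveE// derive_val mulrC.
Qed.

(** Finite orders of differentiability: smoothness of a product or of a composition
    involves lower derivatives of both factors, so it is proved order by order. *)
Definition nsmooth n f :=
  forall (s : seq 'I_N), (size s <= n)%N -> forall x, differentiable (foldr (@pderiv R N) f s) x.

(** The iterated derivatives put the last index outermost, and peeling off the
    innermost one is what makes induction possible. *)
Lemma nsmoothS n f : nsmooth n.+1 f <->
  (forall x, differentiable f x) /\ forall i, nsmooth n (pderiv i f).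
Proof.
split=> [fn|[df fn] s].
  split=> [|i s sn]; first exact: (fn [::]).
  by rewrite -foldr_rcons; apply: fn; rewrite size_rcons.
case/lastP: s => [//|s i]; rewrite size_rcons foldr_rcons => sn.
exact: fn.
Qed.

Lemma nsmooth0 f : nsmooth 0 f <-> forall x, differentiable f x.
Proof. by split => [fn|df [|//] _]; [exact: (fn [::])|]. Qed.

Lemma nsmoothW n f : nsmooth n.+1 f -> nsmooth n f.
Proof. by move=> fn s sn; apply: fn; exact: leqW. Qed.

Lemma nsmooth_diff n f x : nsmooth n f -> differentiable f x.
Proof. by move=> fn; exact: (fn [::]). Qed.

Lemma smoothP f : smooth f <-> forall n, nsmooth n f.
Proof. by split => [sf n s _|sf s]; [exact: sf|exact: (sf (size s))]. Qed.

Lemma nsmoothD n f g : nsmooth n f -> nsmooth n g -> nsmooth n (fun x => f x + g x).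
Proof.
elim: n f g => [|n IH] f g fn gn.
  by apply/nsmooth0 => x; apply: differentiableD; exact: (@nsmooth_diff 0).
apply/nsmoothS; split => [x|i].
  by apply: differentiableD; exact: (@nsmooth_diff n.+1).
rewrite (_ : pderiv _ _ = fun x => pderiv i f x + pderiv i g x); last first.
  by apply/funext => x; rewrite pderivD//; exact: (@nsmooth_diff n.+1).
have [_ f'n] := (nsmoothS _ _).1 fn; have [_ g'n] := (nsmoothS _ _).1 gn.
exact: IH.
Qed.

Lemma nsmoothM n f g : nsmooth n f -> nsmooth n g -> nsmooth n (fun x => f x * g x).
Proof.
elim: n f g => [|n IH] f g fn gn.
  by apply/nsmooth0 => x; apply: differentiableM; exact: (@nsmooth_diff 0).
apply/nsmoothS; split => [x|i].
  by apply: differentiableM; exact: (@nsmooth_diff n.+1).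
rewrite (_ : pderiv _ _ = fun x => f x * pderiv i g x + g x * pderiv i f x); last first.
  by apply/funext => x; rewrite pderivM//; exact: (@nsmooth_diff n.+1).
have [_ f'n] := (nsmoothS _ _).1 fn; have [_ g'n] := (nsmoothS _ _).1 gn.
by apply: nsmoothD; apply: IH => //; exact: nsmoothW.
Qed.

Lemma nsmooth_cst n (a : R) : nsmooth n (fun=> a).
Proof.
elim: n a => [|n IH] a; first by apply/nsmooth0 => x; exact: differentiable_cst.
apply/nsmoothS; split => [x|i]; first exact: differentiable_cst.
by rewrite pderiv_cst.
Qed.

(** A whole sequence of successive derivatives is carried along, because
    differentiating the composition replaces [G j] by [G j.+1]. *)
Lemma nsmooth_comp n G f j : (forall k (t : R), is_derive t 1 (G k) (G k.+1 t)) ->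
  nsmooth n f -> nsmooth n (fun x => G j (f x)).
Proof.
move=> dG; elim: n f j => [|n IH] f j fn.
  apply/nsmooth0 => x; apply: (@differentiable_comp1 _ (G j.+1)) => //.
  exact: (@nsmooth_diff 0).
apply/nsmoothS; split => [x|i].
  apply: (@differentiable_comp1 _ (G j.+1)) => //.
  exact: (@nsmooth_diff n.+1).
rewrite (_ : pderiv _ _ = fun x => G j.+1 (f x) * pderiv i f x); last first.
  apply/funext => x; rewrite (@pderiv_comp1 _ (G j.+1))//.
  exact: (@nsmooth_diff n.+1).
have [_ f'n] := (nsmoothS _ _).1 fn.
by apply: nsmoothM => //; apply: IH; exact: nsmoothW.
Qed.

Lemma smooth_diff f x : smooth f -> differentiable f x.
Proof. by move=> /smoothP/(_ 0)/nsmooth0; exact. Qed.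

Lemma smooth_pderiv i f : smooth f -> smooth (pderiv i f).
Proof. by move=> sf s x; rewrite -foldr_rcons; exact: sf. Qed.

Lemma smooth_continuous f : smooth f -> continuous f.
Proof. by move=> sf x; exact/differentiable_continuous/smooth_diff. Qed.

Lemma smoothD f g : smooth f -> smooth g -> smooth (fun x => f x + g x).
Proof. by move=> /smoothP sf /smoothP sg; apply/smoothP => n; exact: nsmoothD. Qed.

Lemma smoothM f g : smooth f -> smooth g -> smooth (fun x => f x * g x).
Proof. by move=> /smoothP sf /smoothP sg; apply/smoothP => n; exact: nsmoothM. Qed.

Lemma smooth_cst (a : R) : smooth ((fun=> a) : 'rV[R]_N -> R).
Proof. by apply/smoothP => n; exact: nsmooth_cst. Qed.

Lemma smooth_comp G f : (forall k (t : R), is_derive t 1 (G k) (G k.+1 t)) ->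
  smooth f -> smooth (fun x => G 0 (f x)).
Proof. by move=> dG /smoothP sf; apply/smoothP => n; exact: nsmooth_comp. Qed.

Lemma smooth_coord (j : 'I_N) : smooth (fun x : 'rV[R]_N => x ord0 j).
Proof.
apply/smoothP => -[|n]; first by apply/nsmooth0 => x; exact: differentiable_coord.
apply/nsmoothS; split => [x|i]; first exact: differentiable_coord.
by rewrite pderiv_coord; exact: nsmooth_cst.
Qed.

Lemma smooth_expR f : smooth f -> smooth (fun x => expR (f x)).
Proof. by apply: (@smooth_comp (fun=> @expR R)) => _ t; exact: is_derive_expR. Qed.

(** All derivatives of the sine are phase shifts of it, so sine and cosine are
    handled by one sequence of functions. *)
Lemma is_derive_sin_shift (k : nat) (t : R) :
  is_derive t 1 (fun t : R => sin (t + k%:R * (pi / 2))) (sin (t + k.+1%:R * (pi / 2))).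
Proof.
have -> : sin (t + k.+1%:R * (pi / 2)) = cos (t + k%:R * (pi / 2)).
  by rewrite -natr1 mulrDl mul1r addrA sinDpihalf.
rewrite -[cos _]mulr1; apply: (@is_derive1_comp _ sin (fun t => t + k%:R * (pi / 2))).
exact: is_derive_shift.
Qed.

Lemma smooth_sin f : smooth f -> smooth (fun x => sin (f x)).
Proof.
move=> /(smooth_comp is_derive_sin_shift); congr smooth.
by apply/funext => x; rewrite mul0r addr0.
Qed.

Lemma smooth_cos f : smooth f -> smooth (fun x => cos (f x)).
Proof.
move=> /(@smooth_comp (fun k t => sin (t + k.+1%:R * (pi / 2)))) sc.
have /sc : forall k (t : R), is_derive t 1 (fun t : R => sin (t + k.+1%:R * (pi / 2)) : R)
    (sin (t + k.+2%:R * (pi / 2))).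
  by move=> k t; exact: is_derive_sin_shift.
congr smooth; apply/funext => x; rewrite mul1r; exact: sinDpihalf.
Qed.

End smooth_closure.

(** * Test functions *)

Section test_functions.
Context (R : realType) (N : nat) (Omega : set 'rV[R]_N).
Implicit Types (phi psi : 'rV[R]_N -> R).

Local Notation leb := (lebesgue_rV R N).

(** Allowing two supports covers differences as well as products and
    compositions. *)
Lemma test_function_support phi psi (f : 'rV[R]_N -> R) :
  test_function Omega phi -> test_function Omega psi -> smooth f ->
  (forall x, phi x = 0 -> psi x = 0 -> f x = 0) -> test_function Omega f.
Proof.
move=> [_ cphi sphi] [_ cpsi spsi] sf f0.
pose S (g : 'rV[R]_N -> R) : set 'rV[R]_N := closure [set x | g x != 0].
have sub : S f `<=` S phi `|` S psi.
  have cl : closed (S phi `|` S psi) by apply: closedU; exact: closed_closure.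
  rewrite [X in _ `<=` X](closure_id _).1//; apply: closure_subset => x /= fx.
  have [px|px] := eqVneq (phi x) 0; last by left; exact: subset_closure.
  have [qx|qx] := eqVneq (psi x) 0; last by right; exact: subset_closure.
  by rewrite f0 ?eqxx in fx.
split => //; last by move=> x /sub[/sphi|/spsi].
apply: (subclosed_compact _ (compactU cphi cpsi) sub); exact: closed_closure.
Qed.

Lemma test_functionM phi psi : test_function Omega phi -> smooth psi ->
  test_function Omega (fun x => phi x * psi x).
Proof.
move=> tphi spsi; have [sphi _ _] := tphi.
apply: (test_function_support tphi tphi); first exact: smoothM.
by move=> x -> _; rewrite mul0r.
Qed.

Lemma test_functionB phi psi : test_function Omega phi -> test_function Omega psi ->
  test_function Omega (fun x => phi x - psi x).
Proof.
move=> tphi tpsi; have [sphi _ _] := tphi; have [spsi _ _] := tpsi.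
apply: (test_function_support tphi tpsi) => [|x -> ->]; last by rewrite subr0.
under eq_fun do rewrite -mulN1r.
by apply: smoothD => //; apply: smoothM => //; exact: smooth_cst.
Qed.

Lemma test_function_comp (E : R -> R) phi : E 0 = 0 ->
  smooth (fun x => E (phi x)) -> test_function Omega phi ->
  test_function Omega (fun x => E (phi x)).
Proof. by move=> E0 sE tphi; apply: (test_function_support tphi tphi) => // x ->. Qed.

Lemma pderiv_support phi i x :
  ~ closure [set y | phi y != 0] x -> pderiv i phi x = 0.
Proof.
move=> nx; rewrite /pderiv (@near_eq_derive _ _ _ phi (cst 0)).
  exact: derive_cst.
have : nbhs x (~` closure [set y | phi y != 0]).
  by apply: open_nbhs_nbhs; split => //; apply: closed_openC; exact: closed_closure.
apply: filterS => y /= ny; apply/eqP; apply: contrapT => /negP py.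
by apply: ny; exact: subset_closure.
Qed.

Lemma test_function_pderiv phi i :
  test_function Omega phi -> test_function Omega (pderiv i phi).
Proof.
move=> [sphi cphi sub].
have sub' : closure [set x | pderiv i phi x != 0] `<=` closure [set x | phi x != 0].
  rewrite [X in _ `<=` X](closure_id _).1; last exact: closed_closure.
  apply: closure_subset => x /= px; apply: contrapT => /(pderiv_support i) p0.
  by rewrite p0 eqxx in px.
split; first exact: smooth_pderiv.
  by apply: (subclosed_compact _ cphi sub'); exact: closed_closure.
by move=> x /sub' /sub.
Qed.

Lemma test_function_out phi x : test_function Omega phi -> ~ Omega x -> phi x = 0.
Proof.
move=> [_ _ sub] nx; apply/eqP; apply: contrapT => /negP px.
by apply/nx/sub; exact: subset_closure.
Qed.

Lemma test_function_bounded phi : test_function Omega phi ->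
  exists M, forall x, `|phi x| <= M.
Proof.
move=> [sphi cphi _]; apply: (compact_support_bounded cphi).
  exact: smooth_continuous.
move=> x nx; apply/eqP; apply: contrapT => /negP px.
by apply: nx; exact: subset_closure.
Qed.

Lemma smooth_measurable (D : set 'rV[R]_N) phi : smooth phi -> measurable_fun D phi.
Proof.
move=> sphi; apply: measurable_funTS; apply: continuous_measurable_rV.
exact: smooth_continuous.
Qed.

(** The derivative vanishes outside the domain, so its integral over the domain is
    its integral over the whole space. *)
Lemma integral_test_function phi i : test_function Omega phi ->
  (\int[leb]_(x in Omega) (pderiv i phi x)%:E = 0)%E.
Proof.
move=> tphi; have [sphi cphi _] := tphi.
have [M [_ Mb]] := compact_bounded cphi.
rewrite -(@integral_pderiv0 R N i phi (M + 1)).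
- rewrite integral_mkcond; apply: eq_integral => x _; rewrite patchE.
  case: ifPn => // /negP nx; rewrite (test_function_out (test_function_pderiv i tphi))//.
  by move=> Ox; apply: nx; rewrite inE.
- by move=> x; apply/diff_derivable/smooth_diff.
- by apply/smooth_continuous/smooth_pderiv.
- move=> x xM; apply/eqP; apply: contrapT => /negP px.
  have : `|x| <= M + 1 by apply: (Mb (M + 1)); [rewrite ltrDl|exact: subset_closure].
  by rewrite leNgt xM.
Qed.

Context (bOmega : bounded_set Omega) (oOmega : open Omega).

Lemma domain_measurable : measurable Omega.
Proof. exact: open_measurable_rV. Qed.

Lemma domain_finite : (leb Omega < +oo)%E.
Proof.
have [M [_ Mb]] := bOmega; apply: (@lebesgue_rV_bounded _ _ _ (M + 1)).
  exact: domain_measurable.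
by move=> x Ox; apply: (Mb (M + 1)) => //; rewrite ltrDl.
Qed.

Lemma test_function_integrable phi : test_function Omega phi ->
  leb.-integrable Omega (EFin \o phi).
Proof.
move=> tphi; have [sphi _ _] := tphi; have [M phiM] := test_function_bounded tphi.
apply: measurable_bounded_integrable.
- exact: domain_measurable.
- exact: domain_finite.
- exact: smooth_measurable.
- exists M; split; first exact: num_real.
  by move=> z Mz x _ /=; rewrite (le_trans (phiM x))// ltW.
Qed.

(** The second factor only has to be smooth, not compactly supported; this is
    used with a coordinate function in [w01p_lim_grad0]. *)
Lemma test_function_by_parts phi psi i : test_function Omega phi -> smooth psi ->
  \int[leb]_(x in Omega) (phi x * pderiv i psi x) =
  - \int[leb]_(x in Omega) (pderiv i phi x * psi x).
Proof.
move=> tphi spsi; have [sphi _ _] := tphi.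
have t1 := test_functionM tphi (smooth_pderiv i spsi).
have t2 := test_functionM (test_function_pderiv i tphi) spsi.
apply/eqP; rewrite -addr_eq0.
rewrite -(RintegralD domain_measurable (test_function_integrable t1)
  (test_function_integrable t2)).
have /(congr1 fine)/= <- := integral_test_function i (test_functionM tphi spsi).
apply/eqP; congr fine; apply: eq_integral => x _; congr EFin.
by rewrite (pderivM i (smooth_diff x sphi) (smooth_diff x spsi)) [psi x * _]mulrC.
Qed.

End test_functions.

(** * Convergence in L^p through integrals of p-th powers *)

Section lp_convergence.
Context d (T : measurableType d) (R : realType) (mu : {measure set T -> \bar R}).
Context (D : set T) (mD : measurable D).
Implicit Types (f g h : T -> R).

(** The form in which all convergences to zero below are proved: up to an
    arbitrarily small error, [a] is bounded by a multiple of [b]. It takes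
    the place of the Minkowski and Hoelder inequalities. *)
Lemma cvg0_approx (a b : nat -> \bar R) : (forall k, (0 <= a k)%E) ->
  b k @[k --> \oo] --> 0%E ->
  (forall e : R, 0 < e -> exists2 M : R, 0 <= M &
     forall k, (a k <= e%:E + M%:E * b k)%E) ->
  a k @[k --> \oo] --> 0%E.
Proof.
move=> a0 /fine_cvgP[bfin b0] ab.
have key (e : R) : 0 < e -> \forall k \near \oo, (a k < e%:E)%E.
  move=> e0; have e20 : 0 < e / 2 by rewrite divr_gt0.
  have [M M0 abM] := ab _ e20.
  have M1 : 0 < M + 1 by rewrite ltr_wpDl.
  have d0 : 0 < e / 2 / (M + 1) by rewrite divr_gt0.
  have b0' : \forall k \near \oo, `|0 - fine (b k)| < e / 2 / (M + 1).
    by move/cvgrPdist_lt : b0 => /(_ _ d0).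
  near=> k; apply: (le_lt_trans (abM k)).
  have bk : b k \is a fin_num by near: k.
  have : `|0 - fine (b k)| < e / 2 / (M + 1) by near: k.
  rewrite sub0r normrN -(fineK bk) -EFinM -EFinD lte_fin => bke.
  rewrite [ltRHS](splitr e) ltrD2l (le_lt_trans (ler_norm _))// normrM (ger0_norm M0).
  rewrite (@le_lt_trans _ _ ((M + 1) * `|fine (b k)|))//.
    by rewrite ler_wpM2r// lerDl.
  by rewrite mulrC -ltr_pdivlMr.
apply/fine_cvgP; split.
  by apply: filterS (key 1 ltr01) => k ak; rewrite ge0_fin_numE// (lt_trans ak)// ltry.
apply/cvgrPdist_lt => e e0; apply: filterS (key e e0) => k ake.
have afin : a k \is a fin_num by rewrite ge0_fin_numE// (lt_trans ake)// ltry.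
by rewrite sub0r normrN ger0_norm ?fine_ge0// -lte_fin fineK.
Unshelve. all: by end_near. Qed.

Lemma le_integral_comb f g h (c : R) : 0 <= c ->
  measurable_fun D f -> measurable_fun D g -> measurable_fun D h ->
  (forall x, D x -> 0 <= f x) -> (forall x, D x -> 0 <= g x) ->
  (forall x, D x -> 0 <= h x) -> (forall x, D x -> f x <= g x + c * h x) ->
  (\int[mu]_(x in D) (f x)%:E <=
   \int[mu]_(x in D) (g x)%:E + c%:E * \int[mu]_(x in D) (h x)%:E)%E.
Proof.
move=> c0 mf mg mh f0 g0 h0 fgh.
have mgE : measurable_fun D (EFin \o g) by exact/measurable_EFinP.
have mhE : measurable_fun D (EFin \o h) by exact/measurable_EFinP.
have mchE : measurable_fun D (fun x => c%:E * (h x)%:E)%E.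
  by apply: emeasurable_funM => //; exact: measurable_cst.
have h0E x : D x -> (0 <= (h x)%:E)%E by move=> /h0; rewrite lee_fin.
have g0E x : D x -> (0 <= (g x)%:E)%E by move=> /g0; rewrite lee_fin.
have ch0E x : D x -> (0 <= c%:E * (h x)%:E)%E by move=> /h0E; exact: mule_ge0.
rewrite -(ge0_integralZl_EFin mu mD h0E mhE c0) -(ge0_integralD mu mD g0E mgE ch0E mchE).
apply: ge0_le_integral => [//|x /f0|||x Dx].
- by rewrite lee_fin.
- exact/measurable_EFinP.
- exact: emeasurable_funD.
- by rewrite -EFinM -EFinD lee_fin fgh.
Qed.

Context (p : R) (p1 : 1 <= p).
Let p0 : 0 < p. Proof. exact: lt_le_trans ltr01 p1. Qed.

(** The p-th power of the L^p norm; sums and pointwise bounds are easier to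
    integrate than the norm itself. *)
Definition Lp_int f : \bar R := (\int[mu]_(x in D) (`|f x| `^ p)%:E)%E.

Lemma measurable_pow f : measurable_fun D f -> measurable_fun D (fun x => `|f x| `^ p).
Proof.
move=> mf; apply: (@measurableT_comp _ _ _ _ _ _ (@powR R ^~ p)) => //.
exact: measurableT_comp.
Qed.

Lemma Lp_int_ge0 f : (0 <= Lp_int f)%E.
Proof. by apply: integral_ge0 => x _; rewrite lee_fin powR_ge0. Qed.

Lemma powR_comb (x a b c : R) : 0 <= x -> 0 <= a -> 0 <= b -> 0 <= c -> x <= c * (a + b) ->
  x `^ p <= (2 * c) `^ p * a `^ p + (2 * c) `^ p * b `^ p.
Proof.
move=> x0 a0 b0 c0 xab; rewrite -!powRM ?mulr_ge0//.
have xm : x <= 2 * c * Num.max a b.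
  rewrite (le_trans xab)// [2 * c]mulrC -mulrA ler_wpM2l// mulrDl !mul1r.
  by rewrite lerD// le_max lexx ?orbT.
apply: (@le_trans _ _ ((2 * c * Num.max a b) `^ p)).
  by rewrite ge0_ler_powR// ?nnegrE ?(ltW p0)// !mulr_ge0// le_max a0.
by case: (leP a b) => _; rewrite ?lerDl ?lerDr powR_ge0.
Qed.

Lemma Lp_int_le_comb f g h (c : R) : 0 <= c ->
  measurable_fun D f -> measurable_fun D g -> measurable_fun D h ->
  (forall x, D x -> `|f x| <= c * (`|g x| + `|h x|)) ->
  (Lp_int f <= ((2 * c) `^ p)%:E * Lp_int g + ((2 * c) `^ p)%:E * Lp_int h)%E.
Proof.
move=> c0 mf mg mh fgh.
have k0 : 0 <= (2 * c) `^ p by exact: powR_ge0.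
have mh' := measurable_pow mh; have mg' := measurable_pow mg.
have g0E x : D x -> (0 <= (`|g x| `^ p)%:E)%E by rewrite lee_fin powR_ge0.
have mgE : measurable_fun D (fun x => (`|g x| `^ p)%:E) by exact/measurable_EFinP.
rewrite /Lp_int -[X in (_ <= X + _)%E](ge0_integralZl_EFin mu mD g0E mgE k0).
under [X in (X + _)%E]eq_integral do rewrite -EFinM.
apply: (le_integral_comb k0) => //.
- exact: measurable_pow.
- by apply: measurable_funM => //; exact: measurable_cst.
- by move=> x _; rewrite mulr_ge0 ?powR_ge0.
- by move=> x Dx; apply: powR_comb => //; exact: fgh.
Qed.

Lemma Lp_int_lty_comb f g h (c : R) : 0 <= c ->
  measurable_fun D f -> measurable_fun D g -> measurable_fun D h ->
  (forall x, D x -> `|f x| <= c * (`|g x| + `|h x|)) ->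
  (Lp_int g < +oo)%E -> (Lp_int h < +oo)%E -> (Lp_int f < +oo)%E.
Proof.
move=> c0 mf mg mh fgh goo hoo.
have k0 : (0 <= ((2 * c) `^ p)%:E)%E by rewrite lee_fin powR_ge0.
apply: (@le_lt_trans _ _ _ _ _ (Lp_int_le_comb c0 mf mg mh fgh)).
exact: (lte_add_pinfty (lte_mul_pinfty k0 isT goo) (lte_mul_pinfty k0 isT hoo)).
Qed.

Lemma Lp_int_cvg0_comb (f g h : nat -> T -> R) (c : R) : 0 <= c ->
  (forall k, measurable_fun D (f k)) -> (forall k, measurable_fun D (g k)) ->
  (forall k, measurable_fun D (h k)) ->
  (forall k x, D x -> `|f k x| <= c * (`|g k x| + `|h k x|)) ->
  Lp_int (g k) @[k --> \oo] --> 0%E -> Lp_int (h k) @[k --> \oo] --> 0%E ->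
  Lp_int (f k) @[k --> \oo] --> 0%E.
Proof.
move=> c0 mf mg mh fgh g0 h0.
have k0 : 0 <= (2 * c) `^ p by exact: powR_ge0.
apply: (@cvg0_approx _ (fun k => Lp_int (g k) + Lp_int (h k))%E) => [k||e e0].
- exact: Lp_int_ge0.
- by rewrite -[X in _ --> X](adde0 0%E); exact: (cvgeD _ g0 h0).
- exists ((2 * c) `^ p) => // k.
  apply: (le_trans (Lp_int_le_comb c0 (mf k) (mg k) (mh k) (fgh k))).
  by rewrite -(ge0_muleDr _ (Lp_int_ge0 _) (Lp_int_ge0 _)); apply: leeDr; exact: ltW.
Qed.

Lemma measurable_tail g (C r : R) : measurable_fun D g ->
  measurable_fun D (fun x => if `|g x| <= r then 0 else C * `|g x| `^ p).
Proof.
move=> mg; apply: measurable_fun_if => //.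
- apply: measurable_fun_ler; last exact: measurable_cst.
  exact: measurableT_comp.
- apply: (@measurable_funS _ _ _ _ D) => //.
  apply: measurable_funM; [exact: measurable_cst|exact: measurable_pow].
Qed.

(** Dominated convergence: the integrand vanishes as soon as n exceeds |g x|. *)
Lemma tail_small g (e C : R) : 0 < e -> 0 <= C -> measurable_fun D g ->
  (Lp_int g < +oo)%E -> exists n : nat, (\int[mu]_(x in D)
    (if `|g x| <= n%:R then 0 else C * `|g x| `^ p)%:E <= e%:E)%E.
Proof.
move=> e0 C0 mg goo; have mgp := measurable_pow mg.
pose F n x := if `|g x| <= n%:R then 0 else C * `|g x| `^ p.
have ig : mu.-integrable D (fun x => (C * `|g x| `^ p)%:E).
  under eq_fun do rewrite EFinM; apply: integrableZl => //.
  apply/integrableP; split; first exact/measurable_EFinP.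
  by under eq_integral do rewrite /= ger0_norm ?powR_ge0//.
have [||||] := @dominated_convergence _ _ _ mu _ mD (fun n x => (F n x)%:E) (cst 0%E) _ _ _ _ ig.
- by move=> n; apply/measurable_EFinP; exact: measurable_tail.
- exact: measurable_cst.
- apply: aeW => x Dx; apply: cvg_near_cst.
  have [n gn] : exists n : nat, `|g x| <= n%:R.
    by exists (Num.bound `|g x|); rewrite ltW// archi_boundP.
  near=> m; rewrite /F ifT// (le_trans gn)// ler_nat.
  by near: m; exact: nbhs_infty_ge.
- apply: aeW => x n Dx; rewrite /F; case: ifP => _.
    by rewrite /= normr0 lee_fin mulr_ge0 ?powR_ge0.
  by rewrite lee_fin ger0_norm// mulr_ge0 ?powR_ge0.
move=> _ _; rewrite integral0 => /fine_cvgP[ffin /cvgrPdist_lt/(_ _ e0) f0].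
have [n _ /(_ n (leqnn n))[fn fe]] := filterI ffin f0.
exists n; rewrite -[leLHS](fineK fn) lee_fin ltW//.
by move: fe; rewrite sub0r normrN; apply: le_lt_trans; exact: ler_norm.
Unshelve. all: by end_near. Qed.

(** Convergence in L^p of bounded multipliers against a fixed function, without
    passing to an almost everywhere convergent subsequence: where |g| <= n the
    product is at most n L |l|, and the rest has small integral uniformly in k. *)
Lemma Lp_int_cvg0_mul (h l : nat -> T -> R) g (C L : R) : 0 <= C -> 0 <= L ->
  (forall k, measurable_fun D (h k)) -> (forall k, measurable_fun D (l k)) ->
  measurable_fun D g -> (Lp_int g < +oo)%E ->
  (forall k x, D x -> `|h k x| <= C) -> (forall k x, D x -> `|h k x| <= L * `|l k x|) ->
  Lp_int (l k) @[k --> \oo] --> 0%E ->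
  Lp_int (fun x => h k x * g x) @[k --> \oo] --> 0%E.
Proof.
move=> C0 L0 mh ml mg goo hC hL l0.
apply: (@cvg0_approx _ (fun k => Lp_int (l k))) => [k||e e0] //; first exact: Lp_int_ge0.
have [n ne] := tail_small e0 (powR_ge0 C p) mg goo.
exists ((n%:R * L) `^ p); first exact: powR_ge0.
move=> k.
(* A is the part of the product where |g| > n. *)
pose A x := if `|g x| <= n%:R then 0 else C `^ p * `|g x| `^ p.
apply: (@le_trans _ _ (\int[mu]_(x in D) (A x)%:E + ((n%:R * L) `^ p)%:E * Lp_int (l k))%E); last first.
  by rewrite leeD2r.
apply: le_integral_comb => //.
- exact: powR_ge0.
- by apply: measurable_pow; exact: measurable_funM.
- exact: measurable_tail.
- exact: measurable_pow.
- by move=> x _; rewrite /A; case: ifP => // _; rewrite mulr_ge0 ?powR_ge0.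
- move=> x Dx; rewrite /A normrM; case: ifPn => [gn|_].
    rewrite add0r -powRM ?mulr_ge0// ge0_ler_powR ?nnegrE ?mulr_ge0 ?(ltW p0)//.
    by rewrite mulrC -mulrA ler_pM// hL.
  apply: (@le_trans _ _ (C `^ p * `|g x| `^ p)); last first.
    by rewrite lerDl mulr_ge0 ?powR_ge0.
  rewrite powRM//.
  apply: ler_wpM2r; first exact: powR_ge0.
  by rewrite ge0_ler_powR ?nnegrE ?(ltW p0)// hC.
Qed.

(** If |t| > e then |t|^(p-1) > e^(p-1). *)
Lemma abs_le_powR (t e : R) : 0 < e -> `|t| <= e + (e `^ (p - 1))^-1 * `|t| `^ p.
Proof.
move=> e0; have [te|et] := leP `|t| e.
  by rewrite ler_wpDr// mulr_ge0 ?powR_ge0// invr_ge0 powR_ge0.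
rewrite ler_wpDl ?(ltW e0)//.
have t0 : 0 < `|t| by exact: lt_trans et.
rewrite mulrC ler_pdivlMr ?powR_gt0//.
have -> : `|t| `^ p = `|t| `^ (p - 1) * `|t|.
  have t0' : `|t| != 0 by rewrite gt_eqF.
  by rewrite -[in LHS](subrK 1 p) [LHS]powRD ?powRr1// t0' implybT.
rewrite mulrC ler_wpM2r//.
by rewrite ge0_ler_powR ?nnegrE ?subr_ge0 ?(ltW e0) ?(ltW t0)// ltW.
Qed.

Lemma Lp_int_cvg0_L1 (f : nat -> T -> R) : (mu D < +oo)%E ->
  (forall k, measurable_fun D (f k)) -> Lp_int (f k) @[k --> \oo] --> 0%E ->
  (\int[mu]_(x in D) `|f k x|%:E)%E @[k --> \oo] --> 0%E.
Proof.
move=> Dfin mf f0; apply: (@cvg0_approx _ (fun k => Lp_int (f k))) => // [k|e e0].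
  by apply: integral_ge0 => x _; rewrite lee_fin.
pose m := fine (mu D); have mE : mu D = m%:E by rewrite fineK// ge0_fin_numE.
have m0 : 0 <= m by exact: fine_ge0.
(* The constant s of the error term integrates to s * mu D < e. *)
pose s := e / (m + 1); have s0 : 0 < s by rewrite divr_gt0// ltr_wpDl.
have s1 : 0 <= (s `^ (p - 1))^-1 by rewrite invr_ge0 powR_ge0.
exists ((s `^ (p - 1))^-1) => //.
move=> k; apply: (@le_trans _ _ (\int[mu]_(x in D) s%:E + (s `^ (p - 1))^-1%:E * Lp_int (f k))%E).
  apply: le_integral_comb => //.
  - exact: measurableT_comp.
  - exact: measurable_pow.
  - by move=> x _; exact: ltW.
  - by move=> x _; exact: abs_le_powR.
rewrite leeD2r// integral_cst// mE -EFinM lee_fin /s mulrAC ler_pdivrMr ?ltr_wpDl//.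
by rewrite ler_pM2l// lerDl.
Qed.

End lp_convergence.

(** * Lebesgue spaces on the domain *)

(** Used with exponents p and 1 / p, to pass between an L^p norm and its p-th
    power. *)
Lemma poweR_cvg0 (R : realType) (a : nat -> \bar R) (r : R) : 0 < r ->
  (forall k, (0 <= a k)%E) -> a k @[k --> \oo] --> 0%E ->
  (a k `^ r)%E @[k --> \oo] --> 0%E.
Proof.
move=> r0 a0 /fine_cvgP[afin a0'].
have aE : \forall k \near \oo, (a k `^ r)%E = (fine (a k) `^ r)%:E.
  by apply: filterS afin => k ak; rewrite -poweR_EFin fineK.
apply/fine_cvgP; split; first by apply: filterS aE => k ->.
apply/cvgrPdist_lt => e e0.
have e1 : 0 < e `^ r^-1 by rewrite powR_gt0.
have a1 : \forall k \near \oo, `|0 - fine (a k)| < e `^ r^-1.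
  by move/cvgrPdist_lt : a0' => /(_ _ e1).
near=> k; rewrite /=; have -> : (a k `^ r)%E = (fine (a k) `^ r)%:E by near: k.
rewrite /= sub0r normrN ger0_norm ?powR_ge0//=.
have : `|0 - fine (a k)| < e `^ r^-1 by near: k.
rewrite sub0r normrN ger0_norm ?fine_ge0// => ae.
have -> : e = (e `^ r^-1) `^ r by rewrite -powRrM mulVf ?gt_eqF// powRr1// ltW.
by rewrite gt0_ltr_powR// nnegrE ?fine_ge0// ltW.
Unshelve. all: by end_near. Qed.

Section lp_spaces.
Context (R : realType) (N : nat) (Omega : set 'rV[R]_N) (mO : measurable Omega).
Implicit Types (u : 'rV[R]_N -> R).
Local Notation leb := (lebesgue_rV R N).

Section finite_exponent.
Context (p : R) (p1 : 1 <= p).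
Let p0 : 0 < p. Proof. exact: lt_le_trans ltr01 p1. Qed.
Local Notation Ip := (Lp_int leb Omega p).

(** At points outside the domain the restricted function is zero, and so is its p-th
    power since p is not zero. *)
Lemma Lp_normE u : Lp_norm Omega p%:E u = (Ip u `^ p^-1)%E.
Proof.
rewrite /Lp_norm unlock /Lp_int [in RHS]integral_mkcond; congr (_ `^ _)%E.
apply: eq_integral => x _; rewrite /= /patch; case: ifPn => //= _.
by rewrite normr0 powR0// gt_eqF.
Qed.

Lemma LpP u : Lp Omega p%:E u <-> measurable_fun Omega u /\ (Ip u < +oo)%E.
Proof.
have E : (Lp_norm Omega p%:E u < +oo)%E <-> (Ip u < +oo)%E.
  rewrite Lp_normE; split => [h|h].
    by apply: (@lty_poweRy _ _ p^-1) => //; rewrite invr_neq0// gt_eqF.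
  exact: poweR_lty.
rewrite /Lp; split=> [|[mu' up]].
  rewrite inE => /andP[/[!inE]/= mu' fu]; split; last exact/E.
  by apply/(measurable_restrictT _ mO).
rewrite inE; apply/andP; split; rewrite inE/=; last exact/E.
exact/(measurable_restrictT _ mO).
Qed.

Lemma Lp_norm_cvg0 (f : nat -> 'rV[R]_N -> R) :
  Lp_norm Omega p%:E (f k) @[k --> \oo] --> 0%E <->
  Ip (f k) @[k --> \oo] --> 0%E.
Proof.
split=> h; last first.
  under eq_fun do rewrite Lp_normE.
  by apply: poweR_cvg0 => //; [rewrite invr_gt0|move=> k; exact: Lp_int_ge0].
rewrite (_ : (fun k => _) = fun k => (Lp_norm Omega p%:E (f k) `^ p)%E).
  by apply: poweR_cvg0 => // k; exact: Lnorm_ge0.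
apply/funext => k; rewrite Lp_normE -poweRrM mulVf ?gt_eqF// poweRe1//.
exact: Lp_int_ge0.
Qed.

End finite_exponent.

Lemma Lp_inftyP u : Lp Omega +oo u <-> measurable_fun Omega u /\
  exists M, \forall x \ae leb, Omega x -> `|u x| <= M.
Proof.
rewrite /Lp; split=> [|[mu' [M uM]]].
  rewrite inE => /andP[/[!inE]/= mu' fu]; split.
    exact/(measurable_restrictT _ mO).
  move: fu; rewrite /finite_norm unlock; case: ifPn => [_|].
    move=> fu; pose e := ess_sup leb (abse \o (EFin \o u \_ Omega)).
    exists (fine e); have := ess_sup_ge leb (abse \o (EFin \o u \_ Omega)).
    apply: filterS => x /= + Ox; rewrite patchE mem_set// -/e => ue.
    rewrite -lee_fin fineK// fin_numElt fu andbT.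
    by apply: (lt_le_trans _ ue); rewrite ltNyr.
  rewrite -leNgt => mu0 _; exists 0; exists setT; split => //.
  by apply/eqP; rewrite eq_le mu0 measure_ge0.
rewrite inE; apply/andP; split; rewrite inE/=.
  exact/(measurable_restrictT _ mO).
rewrite /finite_norm unlock; case: ifPn => [_|//].
apply: (@le_lt_trans _ _ (`|M|)%:E); last exact: ltry.
apply/ess_supP; apply: filterS uM => x /= uM; rewrite lee_fin patchE.
case: ifPn => [|_]; last by rewrite normr0.
by rewrite inE => /uM /le_trans; apply; exact: ler_norm.
Qed.

End lp_spaces.

(** * Limits of test functions *)

Lemma derive_bounded_lipschitz (R : realType) (F F' : R -> R) (C : R) :
  (forall t : R, is_derive t 1 F (F' t)) -> (forall t, `|F' t| <= C) ->
  forall s t, `|F s - F t| <= C * `|s - t|.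
Proof.
move=> dF FC.
have key a b : a < b -> `|F b - F a| <= C * `|b - a|.
  move=> ab; have [|c _ ->] := @MVT _ F F' a b ab (fun x _ => dF x).
    apply: continuous_subspaceT => x; apply: differentiable_continuous.
    by apply/derivable1_diffP; have := dF x.
  by rewrite normrM ler_wpM2r.
move=> s t; have [st|ts|->] := ltgtP s t.
- by rewrite distrC [X in _ * X]distrC key.
- exact: key.
- by rewrite !subrr normr0 mulr0.
Qed.

Lemma is_derive_continuous (R : realType) (F F' : R -> R) :
  (forall t : R, is_derive t 1 F (F' t)) -> continuous F.
Proof.
move=> dF t; apply: differentiable_continuous; apply/derivable1_diffP.
by have := dF t.
Qed.

Section real_integrable.
Context d (T : measurableType d) (R : realType) (mu : {measure set T -> \bar R}).
Context (D : set T) (mD : measurable D).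
Implicit Types f g : T -> R.

Lemma integrable_funB f g : mu.-integrable D (EFin \o f) ->
  mu.-integrable D (EFin \o g) -> mu.-integrable D (EFin \o (fun x => f x - g x)).
Proof. by move=> fi gi; exact: (integrableB mD fi gi). Qed.

Lemma integrable_funD f g : mu.-integrable D (EFin \o f) ->
  mu.-integrable D (EFin \o g) -> mu.-integrable D (EFin \o (fun x => f x + g x)).
Proof. by move=> fi gi; exact: (integrableD mD fi gi). Qed.

Lemma integrable_funZ f (c : R) : mu.-integrable D (EFin \o f) ->
  mu.-integrable D (EFin \o (fun x => c * f x)).
Proof. by move=> fi; exact: (integrableZl mD c fi). Qed.

End real_integrable.

Section sobolev_limits.
Context (R : realType) (N : nat) (Omega : set 'rV[R]_N).
Context (bOmega : bounded_set Omega) (oOmega : open Omega) (p : R) (p1 : 1 <= p).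
Implicit Types (u v : 'rV[R]_N -> R) (g h : 'rV[R]_N -> 'rV[R]_N).
Implicit Types (phi psi : nat -> 'rV[R]_N -> R).
Local Notation leb := (lebesgue_rV R N).
Local Notation Ip := (Lp_int leb Omega p).
Let mO : measurable Omega := domain_measurable oOmega.
Let Ofin : (leb Omega < +oo)%E := domain_finite bOmega oOmega.
Let p0 : 0 < p. Proof. exact: lt_le_trans ltr01 p1. Qed.

(** [phi] is a sequence of test functions that converges in W^{1,p} to [u], with
    gradients converging to [g]; the approximating sequence is kept explicit so that
    operations can be carried out on it. *)
Definition w01p_lim u g phi := [/\ Lp Omega p%:E u,
  forall i, Lp Omega p%:E (fun x => g x ord0 i),
  forall k, test_function Omega (phi k),
  Ip (fun x => phi k x - u x) @[k --> \oo] --> 0%E &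
  forall i, Ip (fun x => pderiv i (phi k) x - g x ord0 i) @[k --> \oo] --> 0%E].

Lemma Lp_integrable u : Lp Omega p%:E u -> leb.-integrable Omega (EFin \o u).
Proof.
move=> /(LpP mO p1)[mu' up]; apply/integrableP; split; first exact/measurable_EFinP.
apply: (@le_lt_trans _ _ (\int[leb]_(x in Omega) (1 : R)%:E +
    (1 `^ (p - 1))^-1%:E * Ip u)%E).
  apply: le_integral_comb => //.
  - exact: measurableT_comp.
  - exact: measurable_pow.
  - by move=> x _; exact: abs_le_powR.
rewrite powR1 invr1 mul1e lte_add_pinfty//.
by rewrite integral_cst// mul1e.
Qed.

Lemma bounded_mul_integrable u (b : 'rV[R]_N -> R) (M : R) : Lp Omega p%:E u ->
  measurable_fun Omega b -> (forall x, Omega x -> `|b x| <= M) ->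
  leb.-integrable Omega (EFin \o (fun x => u x * b x)).
Proof.
move=> up mb bM; have iu := Lp_integrable up.
have := @integrableMl _ _ _ leb Omega mO (EFin \o u) b iu mb.
apply; exists M; split; first exact: num_real.
by move=> z Mz x /bM /le_trans; apply; exact: ltW.
Qed.

Lemma Rintegral_mul_cvg (f : nat -> 'rV[R]_N -> R) u (b : 'rV[R]_N -> R) (M : R) :
  (forall k, Lp Omega p%:E (f k)) -> Lp Omega p%:E u ->
  measurable_fun Omega b -> (forall x, Omega x -> `|b x| <= M) ->
  Ip (fun x => f k x - u x) @[k --> \oo] --> 0%E ->
  \int[leb]_(x in Omega) (f k x * b x) @[k --> \oo] -->
    \int[leb]_(x in Omega) (u x * b x).
Proof.
move=> fp up mb bM fu.
have mf k : measurable_fun Omega (f k) by have [] := (LpP mO p1 _).1 (fp k).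
have mu' : measurable_fun Omega u by have [] := (LpP mO p1 _).1 up.
have mfu k : measurable_fun Omega (fun x => f k x - u x) by exact: measurable_funB.
have := Lp_int_cvg0_L1 mO p1 Ofin mfu fu.
move=> /fine_cvgP[ffin f0].
have ifb k := bounded_mul_integrable (fp k) mb bM.
have iub := bounded_mul_integrable up mb bM.
have ifu k : leb.-integrable Omega (EFin \o (fun x => f k x - u x)).
  by apply: integrable_funB => //; exact: Lp_integrable.
apply/cvgrPdist_le => e e0.
have M1 : 0 < `|M| + 1 by rewrite ltr_wpDl.
have d0 : 0 < e / (`|M| + 1) by rewrite divr_gt0.
have : \forall k \near \oo, `|0 - fine (\int[leb]_(x in Omega) `|(f k x - u x)|%:E)%E| < e / (`|M| + 1).
  by move/cvgrPdist_lt : f0 => /(_ _ d0).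
apply: filterS => k; rewrite sub0r normrN ltr_pdivlMr// => fe.
rewrite distrC -RintegralB//.
apply: (le_trans (le_normr_Rintegral _ _)) => //.
  exact: integrable_funB.
apply: (@le_trans _ _ (\int[leb]_(x in Omega) ((`|M| + 1) * `|f k x - u x|))).
  apply: le_Rintegral => //.
  - by apply: integrable_norm => //; exact: integrable_funB.
  - apply: integrable_funZ => //; exact: integrable_norm.
  - move=> x Ox; rewrite -mulrBl normrM mulrC ler_wpM2r//.
    by rewrite (le_trans (bM _ Ox))// (le_trans (ler_norm _))// lerDl.
rewrite RintegralZl//; last exact: integrable_norm.
rewrite mulrC; apply: ltW; apply: le_lt_trans fe.
by rewrite ler_wpM2r ?(ltW M1)// ler_norm.
Qed.

Lemma test_function_Lp (f : 'rV[R]_N -> R) : test_function Omega f -> Lp Omega p%:E f.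
Proof.
move=> tf; apply/(LpP mO p1); have [sf _ _] := tf.
split; first exact: smooth_measurable.
have [M fM] := test_function_bounded tf.
apply: (@le_lt_trans _ _ (\int[leb]_(x in Omega) (`|M| `^ p)%:E)%E).
  apply: ge0_le_integral => // [|x _].
  - by apply/measurable_EFinP; apply: measurable_pow; exact: smooth_measurable.
  - rewrite lee_fin ge0_ler_powR ?nnegrE ?(ltW p0)//.
    by rewrite (le_trans (fM x))// ler_norm.
by rewrite integral_cst// lte_mul_pinfty ?lee_fin ?powR_ge0.
Qed.

(** Both sides are limits of the same identity for the test functions [phi k].
    Since it is [phi k] that has compact support, [psi] needs no boundary
    condition. *)
Lemma w01p_lim_by_parts u g phi (psi : 'rV[R]_N -> R) (M : R) i : w01p_lim u g phi ->
  smooth psi -> (forall x, Omega x -> `|psi x| <= M) ->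
  (forall x, Omega x -> `|pderiv i psi x| <= M) ->
  \int[leb]_(x in Omega) (u x * pderiv i psi x) =
  - \int[leb]_(x in Omega) (g x ord0 i * psi x).
Proof.
move=> [up gp tphi phiu dphig] spsi psiM dpsiM.
have c1 : \int[leb]_(x in Omega) (phi k x * pderiv i psi x) @[k --> \oo] -->
    \int[leb]_(x in Omega) (u x * pderiv i psi x).
  apply: (@Rintegral_mul_cvg _ _ _ M) => // [k|]; first exact: test_function_Lp.
  by apply: smooth_measurable; exact: smooth_pderiv.
have c2 : (fun k => - \int[leb]_(x in Omega) (pderiv i (phi k) x * psi x)) k @[k --> \oo] -->
    - \int[leb]_(x in Omega) (g x ord0 i * psi x).
  have tp k := test_function_Lp (test_function_pderiv i (tphi k)).
  have mpsi : measurable_fun Omega psi by exact: smooth_measurable.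
  have h := Rintegral_mul_cvg tp (gp i) mpsi psiM (dphig i).
  exact: (cvgN h).
apply: (cvg_unique (@Rhausdorff R) c1).
rewrite (_ : (fun k => \int[leb]_(x in Omega) (phi k x * pderiv i psi x)) =
  (fun k => - \int[leb]_(x in Omega) (pderiv i (phi k) x * psi x))) //.
by apply/funext => k; exact: test_function_by_parts.
Qed.

Lemma w01p_lim_W1p_grad u g phi : w01p_lim u g phi -> W1p_grad Omega p%:E u g.
Proof.
move=> ug; have [up gp _ _ _] := ug; split => // psi tpsi i.
have [M1 psiM] := test_function_bounded tpsi.
have [M2 dpsiM] := test_function_bounded (test_function_pderiv i tpsi).
have [spsi _ _] := tpsi.
apply: (@w01p_lim_by_parts _ _ _ _ (Num.max M1 M2) _ ug spsi) => x _.
  by rewrite le_max psiM.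
by rewrite le_max dpsiM orbT.
Qed.

Lemma W01pP u : W01p Omega p%:E u <-> exists g phi, w01p_lim u g phi.
Proof.
split=> [[g [phi [ug tphi phiu dphig]]]|[g [phi ug]]].
  exists g, phi; have [up gp _] := ug; split => //.
    exact/(Lp_norm_cvg0 Omega p1 (fun k x => phi k x - u x)).
  move=> i; exact/(Lp_norm_cvg0 Omega p1 (fun k x => pderiv i (phi k) x - g x ord0 i)).
have [up gp tphi phiu dphig] := ug; exists g, phi; split => //.
- exact: w01p_lim_W1p_grad ug.
- exact/(Lp_norm_cvg0 Omega p1 (fun k x => phi k x - u x)).
- move=> i.
  have h := (Lp_norm_cvg0 Omega p1 (fun k x => pderiv i (phi k) x - g x ord0 i)).2.
  exact: h (dphig i).
Qed.

End sobolev_limits.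

(** * Chain rule in W_0^{1,p} *)

Section sobolev_operations.
Context (R : realType) (N : nat) (Omega : set 'rV[R]_N).
Context (bOmega : bounded_set Omega) (oOmega : open Omega) (p : R) (p1 : 1 <= p).
Implicit Types (u v : 'rV[R]_N -> R) (g h : 'rV[R]_N -> 'rV[R]_N).
Implicit Types (phi psi : nat -> 'rV[R]_N -> R).
Local Notation leb := (lebesgue_rV R N).
Local Notation Ip := (Lp_int leb Omega p).
Let mO : measurable Omega := domain_measurable oOmega.
Let Ofin : (leb Omega < +oo)%E := domain_finite bOmega oOmega.

Lemma Lp_measurable u : Lp Omega p%:E u -> measurable_fun Omega u.
Proof. by move=> /(LpP mO p1)[]. Qed.

Lemma Lp_int0 : Ip (fun=> 0) = 0%E.
Proof.
rewrite /Lp_int; under eq_integral do rewrite normr0 powR0 ?gt_eqF ?(lt_le_trans ltr01)//.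
exact: integral0.
Qed.

Lemma Lp_int_cvg0_le (f b : nat -> 'rV[R]_N -> R) (C : R) : 0 <= C ->
  (forall k, measurable_fun Omega (f k)) -> (forall k, measurable_fun Omega (b k)) ->
  (forall k x, Omega x -> `|f k x| <= C * `|b k x|) ->
  Ip (b k) @[k --> \oo] --> 0%E -> Ip (f k) @[k --> \oo] --> 0%E.
Proof.
move=> C0 mf mb fb b0.
have mz (k : nat) : measurable_fun Omega ((fun=> 0) : 'rV[R]_N -> R) by exact: measurable_cst.
have fbz k x : Omega x -> `|f k x| <= C * (`|b k x| + `|0 : R|).
  by move=> Ox; rewrite normr0 addr0 fb.
have z0 : Ip (fun=> 0) @[_ --> \oo] --> 0%E by rewrite Lp_int0; exact: cvg_cst.
exact: (Lp_int_cvg0_comb mO p1 C0 mf mb mz fbz b0 z0).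
Qed.

Lemma Lp_int_lty_le u v (C : R) : 0 <= C -> measurable_fun Omega u -> measurable_fun Omega v ->
  (forall x, Omega x -> `|u x| <= C * `|v x|) -> (Ip v < +oo)%E -> (Ip u < +oo)%E.
Proof.
move=> C0 mu' mv uv voo.
have mz : measurable_fun Omega ((fun=> 0) : 'rV[R]_N -> R) by exact: measurable_cst.
have uvz x : Omega x -> `|u x| <= C * (`|v x| + `|0 : R|).
  by move=> Ox; rewrite normr0 addr0 uv.
have z0 : (Ip (fun=> 0%R) < +oo)%E by rewrite Lp_int0 ltry.
exact: (Lp_int_lty_comb mO p1 C0 mu' mv mz uvz voo z0).
Qed.

Lemma LpB u v : Lp Omega p%:E u -> Lp Omega p%:E v ->
  Lp Omega p%:E (fun x => u x - v x).
Proof.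
move=> /(LpP mO p1)[mu' up] /(LpP mO p1)[mv vp]; apply/(LpP mO p1).
have muv : measurable_fun Omega (fun x => u x - v x) by exact: measurable_funB.
have uv x : Omega x -> `|u x - v x| <= 1 * (`|u x| + `|v x|).
  by move=> _; rewrite mul1r ler_normB.
split; first exact: muv.
exact: (Lp_int_lty_comb mO p1 ler01 muv mu' mv uv up vp).
Qed.

Lemma w01p_limB u v g h phi psi :
  w01p_lim Omega p u g phi -> w01p_lim Omega p v h psi ->
  w01p_lim Omega p (fun x => u x - v x) (fun x => g x - h x)
    (fun k x => phi k x - psi k x).
Proof.
move=> [up gp tphi phiu dphi] [vp hp tpsi psiv dpsi].
have sphi k : smooth (phi k) by have [] := tphi k.
have spsi k : smooth (psi k) by have [] := tpsi k.
have mu' := Lp_measurable up; have mv := Lp_measurable vp.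
split.
- exact: LpB.
- move=> i; under eq_fun do rewrite !mxE; exact: LpB.
- by move=> k; exact: test_functionB.
- have mphi k : measurable_fun Omega (phi k) by exact: smooth_measurable.
  have mpsi k : measurable_fun Omega (psi k) by exact: smooth_measurable.
  have m1 k : measurable_fun Omega (fun x => phi k x - u x) by exact: measurable_funB.
  have m2 k : measurable_fun Omega (fun x => psi k x - v x) by exact: measurable_funB.
  have m3 k : measurable_fun Omega (fun x => phi k x - psi k x - (u x - v x)).
    by apply: measurable_funB; exact: measurable_funB.
  have bnd k x : Omega x -> `|phi k x - psi k x - (u x - v x)| <=
      1 * (`|phi k x - u x| + `|psi k x - v x|).
    move=> _; rewrite mul1r.
    have -> : phi k x - psi k x - (u x - v x) = phi k x - u x - (psi k x - v x) by ring.
    exact: ler_normB.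
  exact: (Lp_int_cvg0_comb mO p1 ler01 m3 m1 m2 bnd phiu psiv).
- move=> i.
  have mg := Lp_measurable (gp i); have mh := Lp_measurable (hp i).
  have dE k x : pderiv i (fun x => phi k x - psi k x) x = pderiv i (phi k) x - pderiv i (psi k) x.
    by rewrite /pderiv deriveB//; apply: diff_derivable; exact: smooth_diff.
  have md k : measurable_fun Omega (pderiv i (phi k)).
    by apply: smooth_measurable; exact: smooth_pderiv.
  have md' k : measurable_fun Omega (pderiv i (psi k)).
    by apply: smooth_measurable; exact: smooth_pderiv.
  have m1 k : measurable_fun Omega (fun x => pderiv i (phi k) x - g x ord0 i).
    exact: measurable_funB.
  have m2 k : measurable_fun Omega (fun x => pderiv i (psi k) x - h x ord0 i).
    exact: measurable_funB.
  pose f k x := pderiv i (fun x => phi k x - psi k x) x - (g x - h x) ord0 i.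
  have fE k x : f k x = pderiv i (phi k) x - g x ord0 i - (pderiv i (psi k) x - h x ord0 i).
    by rewrite /f dE !mxE; ring.
  have m3 k : measurable_fun Omega (f k).
    by rewrite (funext (fE k)); exact: measurable_funB.
  have bnd k x : Omega x -> `|f k x| <=
      1 * (`|pderiv i (phi k) x - g x ord0 i| + `|pderiv i (psi k) x - h x ord0 i|).
    by move=> _; rewrite mul1r fE; exact: ler_normB.
  exact: (Lp_int_cvg0_comb mO p1 ler01 m3 m1 m2 bnd (dphi i) (dpsi i)).
Qed.

(** The gradient of [E (phi k)] minus its expected limit is
    E'(phi_k) (grad phi_k - g) + (E'(phi_k) - E'(u)) g. The first term is controlled
    by the bound on E', the second by [Lp_int_cvg0_mul], since E' is both bounded
    and Lipschitz. *)
Lemma w01p_lim_comp (E E' E'' : R -> R) (C L : R) u g phi :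
  (forall t : R, is_derive t 1 E (E' t)) -> (forall t : R, is_derive t 1 E' (E'' t)) ->
  (forall t, `|E' t| <= C) -> (forall t, `|E'' t| <= L) -> E 0 = 0 ->
  (forall f : 'rV[R]_N -> R, smooth f -> smooth (fun x => E (f x))) ->
  w01p_lim Omega p u g phi ->
  w01p_lim Omega p (fun x => E (u x)) (fun x => E' (u x) *: g x)
    (fun k x => E (phi k x)).
Proof.
move=> dE dE' E'C E''L E0 sE [up gp tphi phiu dphi].
have C0 : 0 <= C by rewrite (le_trans (normr_ge0 (E' 0))).
have L0 : 0 <= L by rewrite (le_trans (normr_ge0 (E'' 0))).
have Elip := derive_bounded_lipschitz dE E'C.
have E'lip := derive_bounded_lipschitz dE' E''L.
have sphi k : smooth (phi k) by have [] := tphi k.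
have mu' := Lp_measurable up.
have mcomp (F F' : R -> R) (w : 'rV[R]_N -> R) : (forall t : R, is_derive t 1 F (F' t)) ->
    measurable_fun Omega w -> measurable_fun Omega (fun x => F (w x)).
  move=> dF mw; apply: measurableT_comp => //.
  by apply: continuous_measurable_fun; exact: is_derive_continuous.
have mphi k : measurable_fun Omega (phi k) by exact: smooth_measurable.
have mEu : measurable_fun Omega (fun x => E (u x)) by exact: (mcomp E E').
have mEphi k : measurable_fun Omega (fun x => E (phi k x)) by exact: (mcomp E E').
have mE'phi k : measurable_fun Omega (fun x => E' (phi k x)) by exact: (mcomp E' E'').
have mE'u : measurable_fun Omega (fun x => E' (u x)) by exact: (mcomp E' E'').
have mphiu k : measurable_fun Omega (fun x => phi k x - u x) by exact: measurable_funB.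
split.
- apply/(LpP mO p1); split; first exact: mEu.
  have bnd x : Omega x -> `|E (u x)| <= C * `|u x|.
    by move=> _; have := Elip (u x) 0; rewrite E0 !subr0.
  have [_ upoo] := (LpP mO p1 _).1 up.
  exact: (Lp_int_lty_le C0 mEu mu' bnd upoo).
- move=> i; have [mg gpoo] := (LpP mO p1 _).1 (gp i).
  under eq_fun do rewrite mxE.
  have m1 : measurable_fun Omega (fun x => E' (u x) * g x ord0 i).
    exact: measurable_funM.
  apply/(LpP mO p1); split; first exact: m1.
  have bnd x : Omega x -> `|E' (u x) * g x ord0 i| <= C * `|g x ord0 i|.
    by move=> _; rewrite normrM ler_wpM2r.
  exact: (Lp_int_lty_le C0 m1 mg bnd gpoo).
- by move=> k; apply: test_function_comp => //; exact: sE (sphi k).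
- have m1 k : measurable_fun Omega (fun x => E (phi k x) - E (u x)) by exact: measurable_funB.
  have bnd k x : Omega x -> `|E (phi k x) - E (u x)| <= C * `|phi k x - u x| by move=> _.
  exact: (Lp_int_cvg0_le C0 m1 mphiu bnd phiu).
- move=> i; have [mg gpoo] := (LpP mO p1 _).1 (gp i).
  have md k : measurable_fun Omega (pderiv i (phi k)).
    by apply: smooth_measurable; exact: smooth_pderiv.
  have dEphi k x : pderiv i (fun x => E (phi k x)) x = E' (phi k x) * pderiv i (phi k) x.
    by apply: pderiv_comp1; exact: smooth_diff.
  pose A k x := E' (phi k x) * (pderiv i (phi k) x - g x ord0 i).
  pose B k x := (E' (phi k x) - E' (u x)) * g x ord0 i.
  pose f k x := pderiv i (fun x => E (phi k x)) x - (E' (u x) *: g x) ord0 i.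
  have fE k x : f k x = A k x + B k x by rewrite /f dEphi mxE /A /B; ring.
  have mdg k : measurable_fun Omega (fun x => pderiv i (phi k) x - g x ord0 i).
    exact: measurable_funB.
  have mE'B k : measurable_fun Omega (fun x => E' (phi k x) - E' (u x)).
    exact: measurable_funB.
  have mA k : measurable_fun Omega (A k) by exact: measurable_funM.
  have mB k : measurable_fun Omega (B k) by exact: measurable_funM.
  have mf k : measurable_fun Omega (f k).
    by rewrite (funext (fE k)); exact: measurable_funD.
  have bnd k x : Omega x -> `|f k x| <= 1 * (`|A k x| + `|B k x|).
    by move=> _; rewrite mul1r fE; exact: ler_normD.
  have bndA k x : Omega x -> `|A k x| <= C * `|pderiv i (phi k) x - g x ord0 i|.
    by move=> _; rewrite /A normrM ler_wpM2r.
  have A0 := Lp_int_cvg0_le C0 mA mdg bndA (dphi i).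
  have bndB1 k x : Omega x -> `|E' (phi k x) - E' (u x)| <= C + C.
    by move=> _; rewrite (le_trans (ler_normB _ _))// lerD.
  have bndB2 k x : Omega x -> `|E' (phi k x) - E' (u x)| <= L * `|phi k x - u x| by move=> _.
  have B0 := Lp_int_cvg0_mul mO p1 (addr_ge0 C0 C0) L0 mE'B mphiu mg gpoo bndB1 bndB2 phiu.
  exact: (Lp_int_cvg0_comb mO p1 ler01 mf mA mB bnd A0 B0).
Qed.

End sobolev_operations.

(** * Functions of W_0^{1,p} without gradient *)

Section real_derivatives.
Context (R : realType).

Lemma is_derive_scale (k : R) (F F' : R -> R) :
  (forall t : R, is_derive t 1 F (F' t)) ->
  forall t : R, is_derive t 1 (fun s => F (k * s)) (k * F' (k * t)).
Proof.
move=> dF t.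
have dk : is_derive t 1 (fun s : R => k * s) k.
  by apply: (is_derive_eq (@is_deriveZ _ _ _ id k t 1 1 _)); rewrite /GRing.scale/= mulr1.
by rewrite mulrC; exact: (@is_derive1_comp _ F (fun s => k * s) t _ _ (dF _) dk).
Qed.

(** The cosine is injective on [0, pi], and pi >= 2 > 1. *)
Lemma cos_eq1 (t : R) : `|t| <= 1 -> cos t = 1 -> t = 0.
Proof.
move=> t1; rewrite -cos_norm -(@cos0 R) => ct.
apply/eqP; rewrite -normr_eq0; apply/eqP; apply: cos_inj ct.
- rewrite in_itv/= normr_ge0 (le_trans t1)// (le_trans _ (pi_ge2 R))//.
  by rewrite ler1n.
- by rewrite in_itv/= lexx pi_ge0.
Qed.

End real_derivatives.

Section ae_integral.
Context d (T : measurableType d) (R : realType) (mu : {measure set T -> \bar R}).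
Context (D : set T) (mD : measurable D).
Implicit Types f g : T -> R.

Lemma ae_eq_Rintegral f g : measurable_fun D f -> measurable_fun D g ->
  (\forall x \ae mu, D x -> f x = g x) ->
  \int[mu]_(x in D) f x = \int[mu]_(x in D) g x.
Proof.
move=> mf mg fg; congr fine; apply: ae_eq_integral => //.
- exact/measurable_EFinP.
- exact/measurable_EFinP.
- by apply: filterS fg => x fg /fg ->.
Qed.

(** For a nonnegative function the integral is the integral of its absolute value. *)
Lemma Rintegral_ge0_eq0 f : mu.-integrable D (EFin \o f) ->
  (\forall x \ae mu, D x -> 0 <= f x) -> \int[mu]_(x in D) f x = 0 ->
  \forall x \ae mu, D x -> f x = 0.
Proof.
move=> fi f0 If; have mf := measurable_int _ fi.
have /(ae_eq_integral_abs mu mD mf) : (\int[mu]_(x in D) `|(EFin \o f) x| = 0)%E.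
  rewrite -[RHS]/((0 : R)%:E) -If /Rintegral fineK ?integrable_fin_num//.
  apply: ae_eq_integral => //; first exact: measurableT_comp.
  by apply: filterS f0 => x fx /fx {}fx; rewrite /= ger0_norm.
by apply: filterS => x fx /fx [].
Qed.

End ae_integral.

Section poincare.
Context (R : realType) (N : nat) (Omega : set 'rV[R]_N).
Context (bOmega : bounded_set Omega) (oOmega : open Omega) (p : R) (p1 : 1 <= p).
Local Notation leb := (lebesgue_rV R N).
Let mO : measurable Omega := domain_measurable oOmega.

(** Integrate F (w) with F t = 1 - cos (k t) by parts against the coordinate
    function x_i: since d(x_i)/dx_i = 1 and F (w) has gradient F'(w) g = 0, the
    integral of F (w) is zero. As F >= 0, F (w) = 0 almost everywhere, and k is so
    small that |k w| <= 1, where F vanishes only at 0. *)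
Lemma w01p_lim_grad0 (w : 'rV[R]_N -> R) g phi (M : R) (i : 'I_N) :
  w01p_lim Omega p w g phi ->
  (\forall x \ae leb, Omega x -> `|w x| <= M) ->
  (\forall x \ae leb, Omega x -> g x = 0) ->
  \forall x \ae leb, Omega x -> w x = 0.
Proof.
move=> wg wM g0.
(* k |w| < 1, where 1 - cos (k t) vanishes only at t = 0. *)
pose k : R := (`|M| + 1)^-1.
have k0 : 0 < k by rewrite invr_gt0 ltr_wpDl.
pose F t : R := 1 - cos (k * t).
pose F' t : R := k * sin (k * t).
pose F'' t : R := k * (k * cos (k * t)).
have dF t : is_derive (t : R) 1 F (F' t).
  have -> : F' t = 0 - k * (- sin (k * t)) by rewrite /F'; ring.
  apply: is_deriveB.
  exact: (is_derive_scale k (@is_derive_cos R)).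
have dF' t : is_derive (t : R) 1 F' (F'' t).
  apply: (@is_deriveZ _ _ _ (fun t => sin (k * t)) k).
  exact: (is_derive_scale k (@is_derive_sin R)).
have F'k t : `|F' t| <= k.
  by rewrite normrM (gtr0_norm k0) ler_piMr ?(ltW k0)// sin_max.
have F''k t : `|F'' t| <= k * k.
  by rewrite !normrM (gtr0_norm k0) ler_wpM2l ?(ltW k0)// ler_piMr ?(ltW k0)// cos_max.
have F0 : F 0 = 0 by rewrite /F mulr0 cos0 subrr.
have sF (f : 'rV[R]_N -> R) : smooth f -> smooth (fun x => F (f x)).
  move=> sf; rewrite /F; under eq_fun do rewrite -[- cos _]mulN1r.
  apply: smoothD; first exact: smooth_cst.
  apply: smoothM; first exact: smooth_cst.
  by apply: smooth_cos; apply: smoothM => //; exact: smooth_cst.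
have Fwg := w01p_lim_comp oOmega p1 dF dF' F'k F''k F0 sF wg.
have [B [_ OB]] := bOmega.
have xB x : Omega x -> `|x ord0 i| <= `|B| + 1.
  move=> Ox; rewrite (le_trans (le_normr_coord x i))//.
  by apply: (OB (`|B| + 1)) => //; rewrite (le_lt_trans (ler_norm _))// ltrDl.
have dB x : Omega x -> `|pderiv i (fun x : 'rV[R]_N => x ord0 i) x| <= `|B| + 1.
  by move=> _; rewrite pderiv_coord eqxx normr1 lerDr.
have := w01p_lim_by_parts bOmega oOmega p1 Fwg (smooth_coord i) xB dB.
rewrite pderiv_coord eqxx.
have [Fwp Fgp _ _ _] := Fwg.
have mFw := Lp_measurable oOmega p1 Fwp.
have mFg := Lp_measurable oOmega p1 (Fgp i).
rewrite [X in _ = - X -> _](_ : _ = 0); last first.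
  rewrite (@ae_eq_Rintegral _ _ _ leb Omega mO _ (fun=> 0)).
  - by rewrite Rintegral_cst// mul0r.
  - by apply: measurable_funM => //; apply: smooth_measurable; exact: smooth_coord.
  - exact: measurable_cst.
  - by apply: filterS g0 => x gx Ox; rewrite gx// scaler0 mxE mul0r.
rewrite oppr0; under eq_Rintegral do rewrite mulr1.
move=> /(Rintegral_ge0_eq0 mO (Lp_integrable bOmega oOmega p1 Fwp)).
have Fw0 : \forall x \ae leb, Omega x -> 0 <= F (w x).
  by apply: aeW => x _; rewrite subr_ge0 cos_le1.
move=> /(_ Fw0); apply: filterS2 wM => x wM Fw Ox.
have /eqP := Fw Ox; rewrite subr_eq0 => /eqP/esym/cos_eq1.
have kw : `|k * w x| <= 1.
  rewrite normrM (gtr0_norm k0) mulrC -ler_pdivlMr// div1r invrK.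
  by rewrite (le_trans (wM Ox))// (le_trans (ler_norm _))// lerDl.
move=> /(_ kw)/eqP; rewrite mulf_eq0 gt_eqF//= => /eqP.
exact.
Qed.

End poincare.

(** * Young's inequality for vectors *)

Section euclidean_vectors.
Context (R : realType) (N : nat).
Implicit Types x y z : 'rV[R]_N.

Lemma dotvC x y : dotv x y = dotv y x.
Proof. by apply: eq_bigr => i _; rewrite mulrC. Qed.

Lemma dotvZl (a : R) x y : dotv (a *: x) y = a * dotv x y.
Proof. by rewrite /dotv mulr_sumr; apply: eq_bigr => i _; rewrite mxE mulrA. Qed.

Lemma dotvZr (a : R) x y : dotv x (a *: y) = a * dotv x y.
Proof. by rewrite dotvC dotvZl dotvC. Qed.

Lemma dotvBl x y z : dotv (x - y) z = dotv x z - dotv y z.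
Proof.
rewrite /dotv -sumrB; apply: eq_bigr => i _; rewrite !mxE; ring.
Qed.

Lemma dotvBr x y z : dotv z (x - y) = dotv z x - dotv z y.
Proof. by rewrite dotvC dotvBl !(dotvC z). Qed.

Lemma dotv_ge0 x : 0 <= dotv x x.
Proof. by apply: sumr_ge0 => i _; rewrite -expr2 sqr_ge0. Qed.

Lemma dotv_eq0 x : dotv x x = 0 -> x = 0.
Proof.
move=> /eqP; rewrite psumr_eq0 => [/allP x0|i _]; last by rewrite -expr2 sqr_ge0.
apply/rowP => i; rewrite mxE; have := x0 i (mem_index_enum i).
by rewrite mulf_eq0 orbb => /eqP.
Qed.

Lemma enorm_ge0 x : 0 <= enorm x. Proof. exact: sqrtr_ge0. Qed.

Lemma enorm_sqr x : enorm x * enorm x = dotv x x.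
Proof. by rewrite -expr2 sqr_sqrtr// dotv_ge0. Qed.

Lemma enorm_eq0 x : enorm x = 0 -> x = 0.
Proof. by move=> x0; apply: dotv_eq0; rewrite -enorm_sqr x0 mul0r. Qed.

Lemma enorm0 : enorm (0 : 'rV[R]_N) = 0.
Proof. by rewrite /enorm -[in dotv 0](scale0r 0) dotvZl mul0r sqrtr0. Qed.

(** The squared norm of |y| x - |x| y equals 2 |x| |y| (|x| |y| - x.y). *)
Lemma dotv_le x y : dotv x y <= enorm x * enorm y.
Proof.
have [->|x0] := eqVneq x 0.
  by rewrite -[in dotv 0](scale0r 0) dotvZl mul0r mulr_ge0 ?enorm_ge0.
have [->|y0] := eqVneq y 0.
  by rewrite -[in dotv _ 0](scale0r 0) dotvZr mul0r mulr_ge0 ?enorm_ge0.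
have xp : 0 < enorm x.
  by rewrite lt_def enorm_ge0 andbT; apply: contra_neq x0; exact: enorm_eq0.
have yp : 0 < enorm y.
  by rewrite lt_def enorm_ge0 andbT; apply: contra_neq y0; exact: enorm_eq0.
have := dotv_ge0 (enorm y *: x - enorm x *: y).
rewrite !(dotvBl, dotvBr, dotvZl, dotvZr) (dotvC y x) -!enorm_sqr.
set a := enorm x in xp *; set b := enorm y in yp *; set s := dotv x y => h.
rewrite -subr_ge0 -(@pmulr_rge0 _ (2 * (a * b))); last by rewrite !mulr_gt0.
by apply: le_trans h _; rewrite le_eqVlt; apply/orP; left; apply/eqP; ring.
Qed.

Lemma normr_dotv_le x y : `|dotv x y| <= enorm x * enorm y.
Proof.
rewrite ler_norml dotv_le andbT lerNl -mulN1r -dotvZl.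
rewrite (le_trans (dotv_le _ _))//; suff -> : enorm (-1 *: x) = enorm x by [].
by rewrite /enorm dotvZl dotvZr mulrA mulrNN !mul1r.
Qed.

End euclidean_vectors.

Section young.
Context (R : realType) (p : R) (p1 : 1 < p).

Lemma powR_pred_mul (r : R) : 0 <= r -> r `^ (p - 2) * r = r `^ (p - 1).
Proof.
rewrite le_eqVlt => /predU1P[<-|r0].
  by rewrite mulr0 powR0// gt_eqF// subr_gt0.
rewrite -{2}(powRr1 (ltW r0)) -powRD ?(gt_eqF r0) ?implybT//.
by congr (_ `^ _); ring.
Qed.

(** With a = e^s, b = e^t and z = (p - 1) t + s, the three terms are multiples of e^z
    by exponentials of (p - 1) (s - t), of t - s, and by 1; the claim is then
    e^r >= 1 + r applied twice, with equality only for r = 0. *)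
Lemma scalar_young (a b : R) : 0 <= a -> 0 < b ->
  0 <= a `^ p + (p - 1) * b `^ p - p * (b `^ (p - 1) * a) /\
  (a `^ p + (p - 1) * b `^ p - p * (b `^ (p - 1) * a) = 0 -> a = b).
Proof.
move=> a0 b0; have p0 : 0 < p by exact: lt_trans p1.
have q0 : 0 < p - 1 by rewrite subr_gt0.
move: a0; rewrite le_eqVlt => /predU1P[<-|a0].
  rewrite powR0 ?gt_eqF// mulr0 mulr0 subr0 add0r.
  have bp : 0 < (p - 1) * b `^ p by rewrite mulr_gt0// powR_gt0.
  by split; [exact: ltW|move=> h; rewrite h ltxx in bp].
pose s := ln a; pose t := ln b; pose z := (p - 1) * t + s.
have aE : a `^ p = expR z * expR ((p - 1) * (s - t)).
  by rewrite /powR gt_eqF// -expRD; congr expR; rewrite /z /s /t; ring.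
have bE : b `^ p = expR z * expR (t - s).
  by rewrite /powR gt_eqF// -expRD; congr expR; rewrite /z /s /t; ring.
have abE : b `^ (p - 1) * a = expR z.
  by rewrite /powR gt_eqF// -{1}(lnK a0) -expRD.
rewrite aE bE abE.
have -> : expR z * expR ((p - 1) * (s - t)) + (p - 1) * (expR z * expR (t - s)) - p * expR z =
  expR z * ((expR ((p - 1) * (s - t)) - (1 + (p - 1) * (s - t))) +
            (p - 1) * (expR (t - s) - (1 + (t - s)))) by ring.
have z0 := expR_gt0 z.
have h1 := expR_ge1Dx ((p - 1) * (s - t)); have h2 := expR_ge1Dx (t - s).
split.
  by rewrite mulr_ge0 ?(ltW z0)// addr_ge0 ?subr_ge0// mulr_ge0 ?subr_ge0// ltW.
move=> /eqP; rewrite mulf_eq0 gt_eqF//= => h.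
have [st|st] := eqVneq (t - s) 0.
  by apply: ln_inj; rewrite ?posrE//; apply/esym/eqP; rewrite -subr_eq0 -/s -/t st.
have h3 := expR_gt1Dx st.
suff : 0 < (expR ((p - 1) * (s - t)) - (1 + (p - 1) * (s - t))) +
            (p - 1) * (expR (t - s) - (1 + (t - s))) by rewrite (eqP h) ltxx.
by rewrite ltr_wpDl ?subr_ge0// mulr_gt0 ?subr_gt0.
Qed.

Context (N : nat).
Implicit Types x y : 'rV[R]_N.

(** The field |x|^(p-2) x of the p-Laplacian. *)
Definition pflux x : 'rV[R]_N := enorm x `^ (p - 2) *: x.

Definition young_gap x y := enorm x `^ p + (p - 1) * enorm y `^ p - p * dotv (pflux y) x.

(** For x = 0 both sides vanish, whatever the sign of p - 2. *)
Lemma dotv_pflux x : dotv (pflux x) x = enorm x `^ p.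
Proof.
rewrite dotvZl -enorm_sqr; have := enorm_ge0 x.
rewrite le_eqVlt => /predU1P[<-|x0].
  by rewrite !mulr0 powR0// gt_eqF// (lt_trans _ p1).
have {2 3}-> : enorm x = enorm x `^ 1 by rewrite powRr1// ltW.
have xn : enorm x != 0 by rewrite gt_eqF.
by rewrite -!powRD ?xn ?implybT//; congr (_ `^ _); ring.
Qed.

(** The gap is the sum of the scalar gap of the norms and of a multiple of the gap
    |y| |x| - y.x in the Cauchy-Schwarz inequality. If both vanish, x and y have the same
    norm and |x - y|^2 = 0. *)
Lemma young_gapP x y : 0 <= young_gap x y /\ (young_gap x y = 0 -> x = y).
Proof.
have p0 : 0 < p by exact: lt_trans p1.
have [->|y0] := eqVneq y 0.
  rewrite /young_gap /pflux scaler0 -[in dotv 0](scale0r 0) dotvZl mul0r enorm0.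
  rewrite powR0 ?gt_eqF// !mulr0 subr0 addr0; split; first exact: powR_ge0.
  by move=> /powR_eq0_eq0/enorm_eq0.
have yp : 0 < enorm y.
  by rewrite lt_def enorm_ge0 andbT; apply: contra_neq y0; exact: enorm_eq0.
have [s0 s1] := scalar_young (enorm_ge0 x) yp.
have bE := esym (powR_pred_mul (enorm_ge0 y)).
have gapE : young_gap x y =
    (enorm x `^ p + (p - 1) * enorm y `^ p - p * (enorm y `^ (p - 1) * enorm x)) +
    p * enorm y `^ (p - 2) * (enorm y * enorm x - dotv y x).
  by rewrite /young_gap /pflux dotvZl bE; ring.
have cs : 0 <= enorm y * enorm x - dotv y x by rewrite subr_ge0 dotv_le.
have k0 : 0 < p * enorm y `^ (p - 2) by rewrite mulr_gt0// powR_gt0.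
have g0 : 0 <= p * enorm y `^ (p - 2) * (enorm y * enorm x - dotv y x).
  by rewrite mulr_ge0// ltW.
rewrite gapE; split; first exact: addr_ge0.
move=> /eqP; rewrite paddr_eq0// => /andP[/eqP/s1 xy].
rewrite mulf_eq0 gt_eqF//= xy subr_eq0 => /eqP yx.
apply/eqP; rewrite -subr_eq0; apply/eqP/dotv_eq0.
by rewrite !(dotvBl, dotvBr) (dotvC x y) -!enorm_sqr xy yx !subrr.
Qed.

Lemma pflux1_mono (s t : R) : s <= t -> `|s| `^ (p - 2) * s <= `|t| `^ (p - 2) * t.
Proof.
have mono (r r' : R) : 0 <= r -> r <= r' -> `|r| `^ (p - 2) * r <= `|r'| `^ (p - 2) * r'.
  move=> r0 rr'; have r'0 := le_trans r0 rr'.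
  by rewrite !ger0_norm// !powR_pred_mul// ge0_ler_powR ?nnegrE ?subr_ge0// ltW.
move=> st; have [s0|s0] := leP 0 s; first exact: mono.
have [t0|t0] := leP 0 t.
  apply: (@le_trans _ _ 0); last by rewrite mulr_ge0 ?powR_ge0.
  by rewrite mulr_ge0_le0 ?powR_ge0 ?(ltW s0).
rewrite -lerN2 -!mulrN -(normrN s) -(normrN t).
by apply: mono; rewrite ?lerN2// oppr_ge0 ltW.
Qed.

Lemma pflux1_exp_ge0 (a s t : R) : 0 <= a ->
  0 <= (`|s| `^ (p - 2) * s - `|t| `^ (p - 2) * t) * (expR (a * s) - expR (a * t)).
Proof.
move=> a0.
have [st|ts] := leP s t.
  by rewrite mulr_le0// subr_le0 ?pflux1_mono// ler_expR ler_wpM2l.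
by rewrite mulr_ge0// subr_ge0 ?pflux1_mono ?(ltW ts)// ler_expR ler_wpM2l// ltW.
Qed.

End young.

(** * Bounded smooth truncations of the exponential *)

Section truncated_exponential.
Context (R : realType) (a : R) (a0 : 0 < a).

(** A composition of elementary functions has explicit derivatives of all orders. For
    large K the inner function K sin (t / K) is close to t, it is bounded by K
    and has derivatives bounded by 1 and 1 / K. *)
Definition texp (K t : R) : R := expR (a * (K * sin (K^-1 * t))) - 1.

Definition texp1 (K t : R) : R :=
  a * cos (K^-1 * t) * expR (a * (K * sin (K^-1 * t))).

Definition texp2 (K t : R) : R :=
  (a * cos (K^-1 * t) * (a * cos (K^-1 * t)) - a * (K^-1 * sin (K^-1 * t))) *
  expR (a * (K * sin (K^-1 * t))).

Lemma is_derive_texp_arg (K t : R) : K != 0 ->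
  is_derive t 1 (fun s => a * (K * sin (K^-1 * s))) (a * cos (K^-1 * t)).
Proof.
move=> K0; have -> : a * cos (K^-1 * t) = a * (K * (K^-1 * cos (K^-1 * t))).
  by rewrite [K * _]mulrA divff// mul1r.
apply: (@is_deriveZ _ _ _ (fun s => K * sin (K^-1 * s)) a).
apply: (@is_deriveZ _ _ _ (fun s => sin (K^-1 * s)) K).
exact: (is_derive_scale K^-1 (@is_derive_sin R)).
Qed.

Lemma is_derive_texp_exp (K t : R) : K != 0 ->
  is_derive t 1 (fun s => expR (a * (K * sin (K^-1 * s)))) (texp1 K t).
Proof.
move=> K0; rewrite /texp1 mulrC.
exact: (@is_derive1_comp _ expR (fun s => a * (K * sin (K^-1 * s))) t _ _
  (is_derive_expR _) (is_derive_texp_arg t K0)).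
Qed.

Lemma is_derive_texp (K t : R) : K != 0 -> is_derive t 1 (texp K) (texp1 K t).
Proof.
move=> K0; rewrite -[texp1 K t]subr0; apply: is_deriveB.
exact: is_derive_texp_exp.
Qed.

Lemma is_derive_texp1 (K t : R) : K != 0 -> is_derive t 1 (texp1 K) (texp2 K t).
Proof.
move=> K0.
have dc : is_derive t 1 (fun s => a * cos (K^-1 * s)) (a * (K^-1 * - sin (K^-1 * t))).
  apply: (@is_deriveZ _ _ _ (fun s => cos (K^-1 * s)) a).
  exact: (is_derive_scale K^-1 (@is_derive_cos R)).
apply: (is_derive_eq (@is_deriveM _ _ _ _ _ _ _ _ dc (is_derive_texp_exp t K0))).
by rewrite /texp2 /texp1 /GRing.scale/=; ring.
Qed.

Lemma texp_arg_le (K t : R) : 0 < K -> a * (K * sin (K^-1 * t)) <= a * K.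
Proof.
by move=> K0; rewrite ler_pM2l// ler_piMr ?sin_le1// ltW.
Qed.

Lemma texp_bound (K t : R) : 0 < K -> `|texp K t| <= expR (a * K) + 1.
Proof.
move=> K0; rewrite (le_trans (ler_normB _ _))// normr1 lerD2r.
by rewrite ger0_norm ?expR_ge0// ler_expR texp_arg_le.
Qed.

Lemma texp1_bound (K t : R) : 0 < K -> `|texp1 K t| <= a * expR (a * K).
Proof.
move=> K0; rewrite !normrM (gtr0_norm a0) (ger0_norm (expR_ge0 _)).
rewrite ler_pM ?expR_ge0 ?mulr_ge0 ?(ltW a0)//.
  by rewrite ler_piMr ?(ltW a0)// cos_max.
by rewrite ler_expR texp_arg_le.
Qed.

Lemma texp2_bound (K t : R) : 0 < K ->
  `|texp2 K t| <= (a * a + a * K^-1) * expR (a * K).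
Proof.
move=> K0; have K1 : 0 < K^-1 by rewrite invr_gt0.
rewrite normrM (ger0_norm (expR_ge0 _)) ler_pM ?expR_ge0//; last first.
  by rewrite ler_expR texp_arg_le.
rewrite (le_trans (ler_normB _ _))// lerD// !normrM (gtr0_norm a0).
  by rewrite ler_pM ?mulr_ge0 ?(ltW a0)// ler_piMr ?(ltW a0)// cos_max.
by rewrite (gtr0_norm K1) ler_wpM2l ?(ltW a0)// ler_piMr ?(ltW K1)// sin_max.
Qed.

Lemma texp0 (K : R) : texp K 0 = 0.
Proof. by rewrite /texp mulr0 sin0 !mulr0 expR0 subrr. Qed.

Lemma smooth_texp (K : R) N (f : 'rV[R]_N -> R) : smooth f -> smooth (fun x => texp K (f x)).
Proof.
move=> sf; rewrite /texp; apply: smoothD; last exact: smooth_cst.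
apply: smooth_expR; apply: smoothM; first exact: smooth_cst.
apply: smoothM; first exact: smooth_cst.
by apply: smooth_sin; apply: smoothM => //; exact: smooth_cst.
Qed.

Lemma sin_le (t : R) : `|sin t| <= `|t|.
Proof.
have := @derive_bounded_lipschitz R sin cos 1 (@is_derive_sin R) (@cos_max R) t 0.
by rewrite sin0 !subr0 mul1r.
Qed.

(** The bound |K sin (t / K)| <= |t| does not involve K, which is what
    dominated convergence for K tending to infinity needs. *)
Lemma texp_arg_unif (K t M : R) : 0 < K -> `|t| <= M ->
  a * (K * sin (K^-1 * t)) <= a * M.
Proof.
move=> K0 tM; rewrite ler_pM2l//; apply: le_trans tM.
rewrite (le_trans (ler_norm _))// normrM (gtr0_norm K0).
rewrite (@le_trans _ _ (K * `|K^-1 * t|))//.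
  by rewrite ler_wpM2l ?(ltW K0)// sin_le.
by rewrite normrM (gtr0_norm (_ : 0 < K^-1)) ?invr_gt0// mulrA divff ?mul1r// gt_eqF.
Qed.

Lemma texp_unif (K t M : R) : 0 < K -> `|t| <= M -> `|texp K t| <= expR (a * M) + 1.
Proof.
move=> K0 tM; rewrite (le_trans (ler_normB _ _))// normr1 lerD2r.
by rewrite ger0_norm ?expR_ge0// ler_expR; exact: texp_arg_unif.
Qed.

Lemma texp1_unif (K t M : R) : 0 < K -> `|t| <= M -> `|texp1 K t| <= a * expR (a * M).
Proof.
move=> K0 tM; rewrite !normrM (gtr0_norm a0) (ger0_norm (expR_ge0 _)).
rewrite ler_pM ?expR_ge0 ?mulr_ge0 ?(ltW a0)//.
  by rewrite ler_piMr ?(ltW a0)// cos_max.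
by rewrite ler_expR; exact: texp_arg_unif.
Qed.

Lemma cvg_scaled0 (t : R) : (n.+1%:R : R)^-1 * t @[n --> \oo] --> (0 : R).
Proof.
rewrite -[X in _ --> X](mul0r t); apply: cvgMl.
exact: cvg_harmonic.
Qed.

(** For t <> 0 this is t (sin h / h) at h = t / (n + 1), and sin h / h tends to the
    derivative of the sine at 0. *)
Lemma cvg_scaled_sin (t : R) :
  (n.+1%:R : R) * sin (n.+1%:R^-1 * t) @[n --> \oo] --> t.
Proof.
have [->|t0] := eqVneq t 0.
  by under eq_fun do rewrite mulr0 sin0 mulr0; exact: cvg_cst.
have d0 : h^-1 *: ((sin \o shift 0) (h *: 1) - sin 0) @[h --> 0^'] --> (1 : R).
  have [] := @is_derive_sin R 0.
  by rewrite cos0 => d dE; rewrite -[X in _ --> X]dE; exact: d.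
have h0 : (n.+1%:R : R)^-1 * t @[n --> \oo] --> 0^'.
  move=> A [e /= e0 eA].
  have := cvg_scaled0 t; move/cvgrPdist_lt => /(_ e e0).
  apply: filterS => n ne; apply: eA => //=.
  by rewrite mulf_neq0// invr_eq0.
rewrite -[X in _ --> X]mulr1.
(* The difference quotient of the sine at 0, along h = t / (n + 1). *)
rewrite (_ : (fun n => _) = (fun n : nat => t * ((fun h => h^-1 *: ((sin \o shift 0) (h *: 1) - sin 0))
  (n.+1%:R^-1 * t)))).
  by apply: cvgM; [exact: cvg_cst|exact: (cvg_comp _ _ h0 d0)].
apply/funext => n; rewrite /= /GRing.scale/= sin0 subr0 addr0 mulr1 invfM invrK.
by rewrite mulrA [t * _]mulrC mulfVK.
Qed.

Lemma cvg_texp_exp (t : R) :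
  expR (a * (n.+1%:R * sin (n.+1%:R^-1 * t))) @[n --> \oo] --> expR (a * t).
Proof.
apply: continuous_cvg; first exact: continuous_expR.
by apply: cvgM; [exact: cvg_cst|exact: cvg_scaled_sin].
Qed.

Lemma cvg_texp (t : R) : texp n.+1%:R t @[n --> \oo] --> expR (a * t) - 1.
Proof. by apply: cvgB; [exact: cvg_texp_exp|exact: cvg_cst]. Qed.

Lemma cvg_texp1 (t : R) : texp1 n.+1%:R t @[n --> \oo] --> a * expR (a * t).
Proof.
apply: cvgM; last exact: cvg_texp_exp.
rewrite -[X in _ --> X](mulr1 a); apply: cvgM; first exact: cvg_cst.
rewrite -[X in _ --> X](@cos0 R); apply: continuous_cvg; first exact: continuous_cos.
exact: cvg_scaled0.
Qed.

End truncated_exponential.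

(** * Integrability of the terms of the equation *)

Section integrability.
Context d (T : measurableType d) (R : realType) (mu : {measure set T -> \bar R}).
Context (D : set T) (mD : measurable D) (N : nat).
Implicit Types (f : T -> R) (g h : T -> 'rV[R]_N).

(** Dominated convergence of a constant sequence. *)
Lemma ae_le_integrable f (b : T -> R) : measurable_fun D f ->
  mu.-integrable D (EFin \o b) -> (\forall x \ae mu, D x -> `|f x| <= b x) ->
  mu.-integrable D (EFin \o f).
Proof.
move=> mf ib fb; have mfE : measurable_fun D (EFin \o f) by exact/measurable_EFinP.
have [||//] := @dominated_convergence _ _ _ mu _ mD (fun=> EFin \o f) _ _ (fun=> mfE) mfE _ ib.
  by apply: aeW => x _; exact: cvg_cst.
by apply: filterS fb => x fb n Dx; rewrite lee_fin fb.
Qed.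

Lemma measurable_dotv g h : (forall i, measurable_fun D (fun x => g x ord0 i)) ->
  (forall i, measurable_fun D (fun x => h x ord0 i)) ->
  measurable_fun D (fun x => dotv (g x) (h x)).
Proof.
move=> mg mh; rewrite /dotv; apply: measurable_sum => i.
exact: measurable_funM.
Qed.

Lemma measurable_enorm g : (forall i, measurable_fun D (fun x => g x ord0 i)) ->
  measurable_fun D (fun x => enorm (g x)).
Proof.
move=> mg; apply: (@measurableT_comp _ _ _ _ _ _ (@Num.sqrt R)).
  by apply: continuous_measurable_fun; exact: sqrt_continuous.
exact: measurable_dotv.
Qed.

Lemma measurable_enorm_powR (r : R) g : (forall i, measurable_fun D (fun x => g x ord0 i)) ->
  measurable_fun D (fun x => enorm (g x) `^ r).
Proof.
move=> mg; apply: (@measurableT_comp _ _ _ _ _ _ (@powR R ^~ r)).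
  exact: measurable_powR.
exact: measurable_enorm.
Qed.

Lemma measurable_dotv_pflux (p : R) g h :
  (forall i, measurable_fun D (fun x => g x ord0 i)) ->
  (forall i, measurable_fun D (fun x => h x ord0 i)) ->
  measurable_fun D (fun x => dotv (pflux p (g x)) (h x)).
Proof.
move=> mg mh; rewrite (_ : (fun x => _) = (fun x => enorm (g x) `^ (p - 2) * dotv (g x) (h x))).
  apply: measurable_funM; first exact: measurable_enorm_powR.
  exact: measurable_dotv.
by apply/funext => x; rewrite dotvZl.
Qed.

End integrability.

Section gradient_bounds.
Context (R : realType) (N : nat).
Implicit Types x y : 'rV[R]_N.

Lemma enorm_le_norm x : enorm x <= Num.sqrt N%:R * `|x|.
Proof.
rewrite -(ger0_norm (normr_ge0 x)) -sqrtr_sqr -sqrtrM ?ler0n//.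
apply: ler_wsqrtr; rewrite /dotv mulr_natl -[X in _ *+ X](card_ord N) -sumr_const.
apply: ler_sum => i _; rewrite -expr2 -real_normK ?num_real// lerXn2r ?nnegrE//.
exact: le_normr_coord.
Qed.

(** The maximum norm is attained at some coordinate. *)
Lemma norm_powR_le_sum (p : R) x : 0 < p -> `|x| `^ p <= \sum_i `|x ord0 i| `^ p.
Proof.
move=> p0; have [x0|/mx_norm_neq0[[i j] /= xij]] := eqVneq (mx_norm x) 0.
  have -> : `|x| = 0 by [].
  by rewrite powR0 ?gt_eqF//; apply: sumr_ge0 => i _; exact: powR_ge0.
have -> : `|x| = `|x ord0 j| by rewrite [LHS]xij (ord1 i).
by rewrite (bigD1 j)//= lerDl; apply: sumr_ge0 => k _; exact: powR_ge0.
Qed.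

Context (p : R) (p1 : 1 < p).
Let p0 : 0 < p. Proof. exact: lt_trans p1. Qed.

(** The Euclidean norm is at most sqrt N times the maximum norm, whose p-th power
    is one of the terms of the sum. *)
Lemma enorm_powR_le x : enorm x `^ p <= Num.sqrt N%:R `^ p * \sum_i `|x ord0 i| `^ p.
Proof.
apply: (@le_trans _ _ ((Num.sqrt N%:R * `|x|) `^ p)).
  by rewrite ge0_ler_powR ?nnegrE ?(ltW p0) ?enorm_ge0 ?mulr_ge0 ?sqrtr_ge0// enorm_le_norm.
by rewrite powRM ?sqrtr_ge0// ler_wpM2l ?powR_ge0// norm_powR_le_sum.
Qed.

(** Bound both factors by the larger of r and s. *)
Lemma young_weak (r s : R) : 0 <= r -> 0 <= s -> r `^ (p - 1) * s <= r `^ p + s `^ p.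
Proof.
move=> r0 s0; pose m := Num.max r s.
have rm : r <= m by rewrite le_max lexx.
have sm : s <= m by rewrite le_max lexx orbT.
have m0 : 0 <= m := le_trans r0 rm.
apply: (@le_trans _ _ (m `^ p)); last first.
  by rewrite /m; case: (leP r s) => _; rewrite ?lerDl ?lerDr powR_ge0.
have -> : m `^ p = m `^ (p - 1) * m.
  have q0 : 0 <= p - 1 by rewrite subr_ge0 ltW.
  move: m0; rewrite le_eqVlt => /predU1P[<-|m0]; first by rewrite mulr0 powR0// gt_eqF.
  rewrite -{3}(powRr1 (ltW m0)) -powRD ?(gt_eqF m0) ?implybT//.
  by congr (_ `^ _); ring.
by rewrite ler_pM ?powR_ge0// ge0_ler_powR ?nnegrE// subr_ge0 ltW.
Qed.

Lemma normr_dotv_pflux_le x y : `|dotv (pflux p x) y| <= enorm x `^ p + enorm y `^ p.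
Proof.
rewrite dotvZl normrM (ger0_norm (powR_ge0 _ _)).
apply: le_trans (young_weak (enorm_ge0 x) (enorm_ge0 y)).
by rewrite -(powR_pred_mul p1) ?enorm_ge0// -mulrA ler_wpM2l ?powR_ge0// normr_dotv_le.
Qed.

Lemma normr_pflux1_le (t M : R) : `|t| <= M -> `| `|t| `^ (p - 2) * t | <= M `^ (p - 1).
Proof.
move=> tM; rewrite normrM (ger0_norm (powR_ge0 _ _)) (powR_pred_mul p1)//.
by rewrite ge0_ler_powR ?nnegrE ?subr_ge0 ?(ltW p1)// (le_trans _ tM).
Qed.

End gradient_bounds.

Lemma enorm_powR_integrable d (T : measurableType d) (R : realType)
    (mu : {measure set T -> \bar R}) (D : set T) (N : nat) (p : R) (g : T -> 'rV[R]_N) :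
  measurable D -> 1 < p -> (forall i, measurable_fun D (fun x => g x ord0 i)) ->
  (forall i, (Lp_int mu D p (fun x => g x ord0 i) < +oo)%E) ->
  mu.-integrable D (EFin \o (fun x => enorm (g x) `^ p)).
Proof.
move=> mD p1 mg gp.
have ig i : mu.-integrable D (fun x => (`|g x ord0 i| `^ p)%:E).
  apply/integrableP; split; first by apply/measurable_EFinP; exact: measurable_pow.
  by under eq_integral do rewrite /= ger0_norm ?powR_ge0//; exact: gp.
apply: (@ae_le_integrable _ _ _ mu D mD _
    (fun x => Num.sqrt N%:R `^ p * \sum_i `|g x ord0 i| `^ p)).
- exact: measurable_enorm_powR.
- apply: integrable_funZ => //.
  rewrite (_ : _ \o _ = fun x => (\sum_i (`|g x ord0 i| `^ p)%:E)%E).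
    by apply: integrable_sum.
  by apply/funext => x /=; rewrite sumEFin.
- by apply: aeW => x _; rewrite ger0_norm ?powR_ge0//; exact: enorm_powR_le.
Qed.

(** * Two solutions have the same gradient *)

Section uniqueness.
Context (R : realType) (N : nat) (Omega : set 'rV[R]_N).
Context (p lambda mu : R) (c h : 'rV[R]_N -> R).
Context (bOmega : bounded_set Omega) (oOmega : open Omega) (p1 : 1 < p).
Local Notation leb := (lebesgue_rV R N).
Context (ic : leb.-integrable Omega (EFin \o c)) (ih : leb.-integrable Omega (EFin \o h)).
Context (c0 : \forall x \ae leb, Omega x -> 0 <= c x) (mu0 : 0 < mu) (lambda0 : lambda <= 0).
Let mO : measurable Omega := domain_measurable oOmega.
Let p1' : 1 <= p := ltW p1.

Definition source (w : 'rV[R]_N -> R) (g : 'rV[R]_N -> 'rV[R]_N) x : R :=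
  lambda * c x * `|w x| `^ (p - 2) * w x + mu * enorm (g x) `^ p + h x.

Lemma measurable_source (w : 'rV[R]_N -> R) (g : 'rV[R]_N -> 'rV[R]_N) : measurable_fun Omega w ->
  (forall i, measurable_fun Omega (fun x => g x ord0 i)) ->
  measurable_fun Omega (source w g).
Proof.
move=> mw mg.
have mc : measurable_fun Omega c by apply/measurable_EFinP; exact: measurable_int ic.
have mh : measurable_fun Omega h by apply/measurable_EFinP; exact: measurable_int ih.
apply: measurable_funD => //; apply: measurable_funD; last first.
  by apply: measurable_funM; [exact: measurable_cst|exact: measurable_enorm_powR].
apply: measurable_funM => //; apply: measurable_funM.
  by apply: measurable_funM => //; exact: measurable_cst.
apply: (@measurableT_comp _ _ _ _ _ _ (@powR R ^~ (p - 2))); first exact: measurable_powR.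
exact: measurableT_comp.
Qed.

Lemma source_le (w : 'rV[R]_N -> R) (g : 'rV[R]_N -> 'rV[R]_N) x (M G : R) : `|w x| <= M -> enorm (g x) `^ p <= G ->
  `|c x| <= G -> `|h x| <= G ->
  `|source w g x| <= (`|lambda| * M `^ (p - 1) + mu + 1) * G.
Proof.
move=> wM gG cG hG.
rewrite (le_trans (ler_normD _ _))// mulrDl mul1r lerD//.
rewrite (le_trans (ler_normD _ _))// mulrDl lerD//.
  rewrite -!mulrA normrM ler_wpM2l// normrM [leRHS]mulrC.
  by apply: ler_pM => //; exact: normr_pflux1_le.
by rewrite normrM (gtr0_norm mu0) (ger0_norm (powR_ge0 _ _)) ler_wpM2l// ltW.
Qed.

Lemma flux_le (X Y Z : 'rV[R]_N) (s t S : R) : `|s| <= S -> `|t| <= S ->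
  `|dotv (pflux p X) (s *: Y - t *: Z)| <=
  S * (enorm X `^ p + enorm Y `^ p + (enorm X `^ p + enorm Z `^ p)).
Proof.
move=> sS tS; rewrite dotvBr !dotvZr (le_trans (ler_normB _ _))// mulrDr lerD//.
  by rewrite normrM ler_pM// normr_dotv_pflux_le.
by rewrite normrM ler_pM// normr_dotv_pflux_le.
Qed.

(** The algebraic heart of the proof. With mu = (p - 1) beta and the exponent
    a = p beta, the p beta U |X|^p of the left-hand side and the term
    - mu (|X|^p - |Y|^p) U add up to beta U (|X|^p + (p - 1) |Y|^p), and
    likewise for V; no other choice of a makes both brackets a Young gap. The numbers
    m, n stand for |u|^(p-2) u and |v|^(p-2) v, and k for h, which cancels. *)
Lemma flux_identity (beta U V C m n k : R) (X Y : 'rV[R]_N) : mu = (p - 1) * beta ->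
  dotv (pflux p X) ((p * beta * U) *: X - (p * beta * V) *: Y) -
  dotv (pflux p Y) ((p * beta * U) *: X - (p * beta * V) *: Y) -
  ((lambda * C * m + mu * enorm X `^ p + k) * (U - 1 - (V - 1)) -
   (lambda * C * n + mu * enorm Y `^ p + k) * (U - 1 - (V - 1))) =
  beta * (U * young_gap p X Y + V * young_gap p Y X) -
  lambda * (C * ((m - n) * (U - V))).
Proof.
move=> ->; rewrite /young_gap !dotvBr !dotvZr !(dotv_pflux p1); ring.
Qed.

Context (u v : 'rV[R]_N -> R) (gu gv : 'rV[R]_N -> 'rV[R]_N).
Context (phi psi : nat -> 'rV[R]_N -> R) (M : R).
Context (Lu : w01p_lim Omega p u gu phi) (Lv : w01p_lim Omega p v gv psi).
Context (uM : \forall x \ae leb, Omega x -> `|u x| <= M).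
Context (vM : \forall x \ae leb, Omega x -> `|v x| <= M).
Context (wu : weak_solution Omega p lambda mu c h u).
Context (wv : weak_solution Omega p lambda mu c h v).

(** [F n] is the integrand of the subtracted identity for the test function built
    with [texp a (K n)], so its integral is zero; [F_] is its limit, which
    [flux_identity] shows to be a sum of nonnegative terms. *)
Lemma weak_solution_grad_eq : \forall x \ae leb, Omega x -> gu x = gv x.
Proof.
have p0 : 0 < p := lt_trans ltr01 p1.
have q0 : 0 < p - 1 by rewrite subr_gt0.
pose beta := mu / (p - 1).
have muE : mu = (p - 1) * beta by rewrite /beta mulrC divfK// gt_eqF.
have beta0 : 0 < beta by rewrite divr_gt0.
pose a := p * beta; have a0 : 0 < a by rewrite mulr_gt0.
have [mu' mv] : measurable_fun Omega u /\ measurable_fun Omega v.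
  have [up _ _ _ _] := Lu; have [vp _ _ _ _] := Lv.
  by split; [exact: (Lp_measurable oOmega p1' up)|exact: (Lp_measurable oOmega p1' vp)].
have [mgu gup] : (forall i, measurable_fun Omega (fun x => gu x ord0 i)) /\
    forall i, (Lp_int leb Omega p (fun x => gu x ord0 i) < +oo)%E.
  by have [_ gp _ _ _] := Lu; split => i; have [] := (LpP mO p1' _).1 (gp i).
have [mgv gvp] : (forall i, measurable_fun Omega (fun x => gv x ord0 i)) /\
    forall i, (Lp_int leb Omega p (fun x => gv x ord0 i) < +oo)%E.
  by have [_ gp _ _ _] := Lv; split => i; have [] := (LpP mO p1' _).1 (gp i).
pose K (n : nat) : R := n.+1%:R.
have K0 n : 0 < K n by rewrite /K ltr0n.
have Kn0 n : K n != 0 by rewrite gt_eqF.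
pose s n x := texp a (K n) (u x) - texp a (K n) (v x).
pose ds n x := texp1 a (K n) (u x) *: gu x - texp1 a (K n) (v x) *: gv x.
have Ls n : exists f, w01p_lim Omega p (s n) (ds n) f.
  have comp (w : 'rV[R]_N -> R) (g : 'rV[R]_N -> 'rV[R]_N) f : w01p_lim Omega p w g f -> w01p_lim Omega p
      (fun x => texp a (K n) (w x)) (fun x => texp1 a (K n) (w x) *: g x)
      (fun k x => texp a (K n) (f k x)).
    exact: (w01p_lim_comp oOmega p1' (fun t => is_derive_texp a t (Kn0 n))
      (fun t => is_derive_texp1 a t (Kn0 n)) (fun t => texp1_bound a0 t (K0 n))
      (fun t => texp2_bound a0 t (K0 n)) (texp0 a (K n))
      (fun f => @smooth_texp R a (K n) N f)).
  by eexists; exact: (w01p_limB oOmega p1' (comp _ _ _ Lu) (comp _ _ _ Lv)).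
have ms n : measurable_fun Omega (s n).
  by have [f [sp _ _ _ _]] := Ls n; exact: (Lp_measurable oOmega p1' sp).
have mds n i : measurable_fun Omega (fun x => ds n x ord0 i).
  by have [f [_ dsp _ _ _]] := Ls n; exact: (Lp_measurable oOmega p1' (dsp i)).
have sW n : W01p Omega p%:E (s n).
  by have [f sf] := Ls n; apply/(W01pP bOmega oOmega p1'); exists (ds n), f.
have sG n : W1p_grad Omega p%:E (s n) (ds n).
  by have [f sf] := Ls n; exact: (w01p_lim_W1p_grad bOmega oOmega p1' sf).
have sinf n : Lp Omega +oo%E (s n).
  apply/(Lp_inftyP mO); split; first exact: ms.
  exists (expR (a * K n) + 1 + (expR (a * K n) + 1)); apply: aeW => x _.
  by rewrite (le_trans (ler_normB _ _))// lerD// texp_bound.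
have eqU n : \int[leb]_(x in Omega) dotv (pflux p (gu x)) (ds n x) =
    \int[leb]_(x in Omega) (source u gu x * s n x).
  have [_ _ w] := wu.
  exact: w (w01p_lim_W1p_grad bOmega oOmega p1' Lu) _ _ (sW n) (sinf n) (sG n).
have eqV n : \int[leb]_(x in Omega) dotv (pflux p (gv x)) (ds n x) =
    \int[leb]_(x in Omega) (source v gv x * s n x).
  have [_ _ w] := wv.
  exact: w (w01p_lim_W1p_grad bOmega oOmega p1' Lv) _ _ (sW n) (sinf n) (sG n).
(* G dominates every term of the equations, up to a constant. *)
pose G x : R := enorm (gu x) `^ p + enorm (gv x) `^ p + (`|c x| + `|h x|).
have iG : leb.-integrable Omega (EFin \o G).
  apply: integrable_funD => //; apply: integrable_funD => //.
  - exact: (enorm_powR_integrable mO p1 mgu gup).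
  - exact: (enorm_powR_integrable mO p1 mgv gvp).
  - exact: integrable_norm.
  - exact: integrable_norm.
have guG x : enorm (gu x) `^ p <= G x.
  by rewrite /G -addrA lerDl !addr_ge0 ?powR_ge0.
have gvG x : enorm (gv x) `^ p <= G x.
  by rewrite /G -addrA addrCA lerDl !addr_ge0 ?powR_ge0.
have cG x : `|c x| <= G x.
  by rewrite /G addrCA lerDl !addr_ge0 ?powR_ge0.
have hG x : `|h x| <= G x.
  by rewrite /G addrA lerDr !addr_ge0 ?powR_ge0.
have G0 x : 0 <= G x by exact: le_trans (powR_ge0 _ _) (guG x).
(* Bounds for texp1 and for s n that are uniform in n where |u|, |v| <= M. *)
pose S := a * expR (a * M); pose E := (expR (a * M) + 1) + (expR (a * M) + 1).
pose B := `|lambda| * M `^ (p - 1) + mu + 1.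
have S0 : 0 <= S by rewrite mulr_ge0 ?expR_ge0// ltW.
have sM n x : `|u x| <= M -> `|v x| <= M -> `|s n x| <= E.
  by move=> ux vx; rewrite (le_trans (ler_normB _ _))// lerD//; exact: texp_unif.
have fluxG n x (X : 'rV[R]_N) : `|u x| <= M -> `|v x| <= M -> enorm X `^ p <= G x ->
    `|dotv (pflux p X) (ds n x)| <= S * 4 * G x.
  move=> ux vx XG; apply: (le_trans (flux_le _ _ _
    (texp1_unif a0 (K0 n) ux) (texp1_unif a0 (K0 n) vx))).
  rewrite -/S -mulrA ler_wpM2l//.
  have := guG x; have := gvG x; move: XG; lra.
have B0 : 0 <= B by rewrite !addr_ge0 ?mulr_ge0 ?powR_ge0// ltW.
have srcG n (w : 'rV[R]_N -> R) (g : 'rV[R]_N -> 'rV[R]_N) x : `|u x| <= M -> `|v x| <= M -> `|w x| <= M ->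
    enorm (g x) `^ p <= G x -> `|source w g x * s n x| <= B * E * G x.
  move=> ux vx wx gx; rewrite normrM mulrAC ler_pM//; last exact: sM.
  exact: source_le.
have bnd (f : 'rV[R]_N -> R) (C : R) : measurable_fun Omega f ->
    (forall x, `|u x| <= M -> `|v x| <= M -> `|f x| <= C * G x) ->
    leb.-integrable Omega (EFin \o f).
  move=> mf fC; apply: (@ae_le_integrable _ _ _ leb Omega mO _ (fun x => C * G x) mf).
    exact: integrable_funZ.
  by apply: filterS2 uM vM => x ux vx Ox; apply: fC; [exact: ux|exact: vx].
have i1 n : leb.-integrable Omega (EFin \o (fun x => dotv (pflux p (gu x)) (ds n x))).
  apply: (bnd _ (S * 4)); first exact: measurable_dotv_pflux.
  by move=> x ux vx; exact: fluxG.
have i2 n : leb.-integrable Omega (EFin \o (fun x => dotv (pflux p (gv x)) (ds n x))).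
  apply: (bnd _ (S * 4)); first exact: measurable_dotv_pflux.
  by move=> x ux vx; exact: fluxG.
have i3 n : leb.-integrable Omega (EFin \o (fun x => source u gu x * s n x)).
  apply: (bnd _ (B * E)); last by move=> x ux vx; exact: srcG.
  by apply: measurable_funM => //; exact: measurable_source.
have i4 n : leb.-integrable Omega (EFin \o (fun x => source v gv x * s n x)).
  apply: (bnd _ (B * E)); last by move=> x ux vx; exact: srcG.
  by apply: measurable_funM => //; exact: measurable_source.
pose F n x := dotv (pflux p (gu x)) (ds n x) - dotv (pflux p (gv x)) (ds n x) -
  (source u gu x * s n x - source v gv x * s n x).
have iF n : leb.-integrable Omega (EFin \o F n).
  by apply: integrable_funB => //; exact: integrable_funB.
have F0 n : \int[leb]_(x in Omega) F n x = 0.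
  rewrite RintegralB//; [|exact: integrable_funB|exact: integrable_funB].
  by rewrite !RintegralB// eqU eqV subrr.
pose U x := expR (a * u x); pose V x := expR (a * v x).
pose F_ x := dotv (pflux p (gu x)) ((p * beta * U x) *: gu x - (p * beta * V x) *: gv x) -
  dotv (pflux p (gv x)) ((p * beta * U x) *: gu x - (p * beta * V x) *: gv x) -
  (source u gu x * (U x - 1 - (V x - 1)) - source v gv x * (U x - 1 - (V x - 1))).
have FF x : F n x @[n --> \oo] --> F_ x.
  have cs : s n x @[n --> \oo] --> U x - 1 - (V x - 1).
    by apply: cvgB; exact: cvg_texp.
  have cd (X : 'rV[R]_N) : dotv (pflux p X) (ds n x) @[n --> \oo] -->
      dotv (pflux p X) ((p * beta * U x) *: gu x - (p * beta * V x) *: gv x).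
    under eq_fun do rewrite /ds dotvBr !dotvZr.
    rewrite dotvBr !dotvZr; apply: cvgB; apply: cvgMl; exact: cvg_texp1.
  by apply: cvgB; apply: cvgB => //; apply: cvgMr.
have mF n : measurable_fun Omega (F n).
  by apply/measurable_EFinP; exact: measurable_int (iF n).
have mF_ : measurable_fun Omega F_ := measurable_fun_cvg mF (fun x _ => FF x).
(* F n consists of two flux terms, each at most S * 4 * G, and of two source
   terms, each at most B * E * G. *)
pose C := S * 8 + B * E * 2.
have mFE n : measurable_fun Omega (fun x => (F n x)%:E) := measurable_int _ (iF n).
have mF_E : measurable_fun Omega (EFin \o F_) by exact/measurable_EFinP.
have FFE : \forall x \ae leb, Omega x -> (F n x)%:E @[n --> \oo] --> (F_ x)%:E.
  by apply: aeW => x _; apply: cvg_EFin; [exact: nearW|exact: FF].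
have iCG : leb.-integrable Omega (fun x => (C * G x)%:E) := integrable_funZ mO C iG.
have FCG : \forall x \ae leb, forall n, Omega x -> (`|(F n x)%:E| <= (C * G x)%:E)%E.
  apply: filterS2 uM vM => x ux vx n Ox; rewrite lee_fin.
  have h1 := fluxG n x _ (ux Ox) (vx Ox) (guG x).
  have h2 := fluxG n x _ (ux Ox) (vx Ox) (gvG x).
  have h3 := srcG n u gu x (ux Ox) (vx Ox) (ux Ox) (guG x).
  have h4 := srcG n v gv x (ux Ox) (vx Ox) (vx Ox) (gvG x).
  have h5 := le_trans (ler_normB _ _) (lerD h1 h2).
  have h6 := le_trans (ler_normB _ _) (lerD h3 h4).
  apply: le_trans (le_trans (ler_normB _ _) (lerD h5 h6)) _.
  by rewrite /C le_eqVlt; apply/orP; left; apply/eqP; ring.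
have [iF_ _ cF] := dominated_convergence mO mFE mF_E FFE iCG FCG.
have IF_ : \int[leb]_(x in Omega) F_ x = 0.
  have F0E n : (\int[leb]_(x in Omega) (F n x)%:E)%E = 0%E.
    rewrite -(fineK (integrable_fin_num mO (iF n))).
    exact: (congr1 EFin (F0 n)).
  have cF0 : (0 : \bar R)%E @[n --> \oo] --> (\int[leb]_(x in Omega) (F_ x)%:E)%E.
    by move: cF; under eq_fun do rewrite F0E.
  by rewrite /Rintegral -(cvg_lim _ cF0)// lim_cst.
have FE x : F_ x = beta * (U x * young_gap p (gu x) (gv x) + V x * young_gap p (gv x) (gu x)) -
    lambda * (c x * ((`|u x| `^ (p - 2) * u x - `|v x| `^ (p - 2) * v x) * (U x - V x))).
  by rewrite -(flux_identity _ _ _ _ _ (h x) _ _ muE) /F_ /source -!mulrA.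
have gap0 x : Omega x -> 0 <= c x -> 0 <= beta * (U x * young_gap p (gu x) (gv x) +
    V x * young_gap p (gv x) (gu x)) /\ 0 <= - lambda *
    (c x * ((`|u x| `^ (p - 2) * u x - `|v x| `^ (p - 2) * v x) * (U x - V x))).
  move=> Ox cx; split.
    rewrite mulr_ge0 ?(ltW beta0)// addr_ge0// mulr_ge0 ?expR_ge0//.
      by have [] := young_gapP p1 (gu x) (gv x).
    by have [] := young_gapP p1 (gv x) (gu x).
  rewrite mulr_ge0 ?oppr_ge0// mulr_ge0//.
  exact: pflux1_exp_ge0 (ltW a0).
have F_ge0 : \forall x \ae leb, Omega x -> 0 <= F_ x.
  apply: filterS c0 => x cx Ox; have [h1 h2] := gap0 x Ox (cx Ox).
  by rewrite FE -mulNr addr_ge0.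
have := Rintegral_ge0_eq0 mO iF_ F_ge0 IF_.
apply: filterS2 c0 => x cx Fx Ox; have [h1 h2] := gap0 x Ox (cx Ox).
have /eqP := Fx Ox; rewrite FE -mulNr paddr_eq0// => /andP[+ _].
have [g1 g1e] := young_gapP p1 (gu x) (gv x); have [g2 _] := young_gapP p1 (gv x) (gu x).
rewrite mulf_eq0 gt_eqF//= paddr_eq0 ?mulr_ge0 ?expR_ge0// => /andP[+ _].
by rewrite mulf_eq0 gt_eqF ?expR_gt0//= => /eqP.
Qed.

End uniqueness.

(** * Uniqueness *)

Theorem theorem1p2 (R : realType) (N : nat) (Omega : set 'rV[R]_N)
    (p q lambda mu : R) (c h : 'rV[R]_N -> R)
    (p_gt1 : 1 < p) (N_ge2 : (2 <= N)%N)
    (Omega_open : open Omega) (Omega_neq0 : Omega !=set0)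
    (Omega_connected : connected Omega) (Omega_bounded : bounded_set Omega)
    (Omega_lipschitz : lipschitz_boundary Omega)
    (q_gt : Num.max (N%:R / p) 1 < q)
    (c_Lq : Lp Omega q%:E c) (h_Lq : Lp Omega q%:E h)
    (c_ge0 : \forall x \ae lebesgue_rV R N, Omega x -> 0 <= c x)
    (c_neq0 : (0 < lebesgue_rV R N (Omega `&` [set x | (0 < c x)%R]))%E)
    (mu_gt0 : 0 < mu) (lambda_le0 : lambda <= 0) (u v : 'rV[R]_N -> R) :
  weak_solution Omega p lambda mu c h u ->
  weak_solution Omega p lambda mu c h v ->
  \forall x \ae lebesgue_rV R N, Omega x -> u x = v x.
Proof.
move=> wu wv; have p1 := ltW p_gt1; have mO := domain_measurable Omega_open.
have q1 : 1 <= q by move: q_gt; rewrite gt_max => /andP[_ /ltW].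
have ic := Lp_integrable Omega_bounded Omega_open q1 c_Lq.
have ih := Lp_integrable Omega_bounded Omega_open q1 h_Lq.
have [/(W01pP Omega_bounded Omega_open p1)[gu [phi Lu]] uoo _] := wu.
have [/(W01pP Omega_bounded Omega_open p1)[gv [psi Lv]] voo _] := wv.
have [_ [M1 uM1]] := (Lp_inftyP mO u).1 uoo.
have [_ [M2 vM2]] := (Lp_inftyP mO v).1 voo.
pose M : R := Num.max M1 M2.
have uM : \forall x \ae lebesgue_rV R N, Omega x -> `|u x| <= M.
  apply: filterS uM1 => x uM1 Ox.
  by rewrite (le_trans (uM1 Ox))// le_max lexx.
have vM : \forall x \ae lebesgue_rV R N, Omega x -> `|v x| <= M.
  apply: filterS vM2 => x vM2 Ox.
  by rewrite (le_trans (vM2 Ox))// le_max lexx orbT.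
have guv := weak_solution_grad_eq Omega_bounded Omega_open p_gt1 ic ih c_ge0 mu_gt0
  lambda_le0 Lu Lv uM vM wu wv.
have Luv := w01p_limB Omega_open p1 Lu Lv.
have uvM : \forall x \ae lebesgue_rV R N, Omega x -> `|u x - v x| <= M + M.
  apply: filterS2 uM vM => x ux vx Ox.
  by rewrite (le_trans (ler_normB _ _))// lerD ?ux ?vx.
have guv0 : \forall x \ae lebesgue_rV R N, Omega x -> gu x - gv x = 0.
  by apply: filterS guv => x xE Ox; rewrite xE// subrr.
have uv0 := w01p_lim_grad0 Omega_bounded Omega_open p1 (Ordinal (ltnW N_ge2)) Luv uvM guv0.
by apply: filterS uv0 => x uv Ox; apply/eqP; rewrite -subr_eq0 uv.
Qed.
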